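(* Let $p$ be a prime, let $n$ be a positive integer, and let $G$ be the Demushkin pro-$p$ group of infinite rank defined by the pro-$p$ presentation \[G:=\langle x_1, x_2, x_3, \ldots \mid x_1^{p^n}[x_1, x_2][x_3, x_4][x_5, x_6]\cdots \rangle.\] The pro-$p$ group $G \times \mathbb{Z}_p$ is Frattini-resistant but not strongly Frattini-resistant.
   Context: The presentation is in the category of pro-$p$ groups: $G=F/R$, where $F$ is the free pro-$p$ group on the countably infinite set $\{x_1,x_2,x_3,\ldots\}$ converging to $1$, and $R$ is the closed normal subgroup of $F$ generated by the (convergent) infinite product $x_1^{p^n}[x_1,x_2][x_3,x_4][x_5,x_6]\cdots$. Here $[x,y]=x^{-1}y^{-1}xy$. For a pro-$p$ group $H$, the Frattini subgroup is $\Phi(H)=\overline{H^p[H,H]}$. A pro-$p$ group $G$ is Frattini-resistant if for all topologically finitely generated closed subgroups $H,K$ of $G$: $\Phi(H)\le\Phi(K)\Leftrightarrow H\le K$. It is strongly Frattini-resistant if this equivalence holds for all closed subgroups $H,K$ of $G$. *)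

(* Defs.v *)
From HB Require Import structures.
From mathcomp Require Import all_boot all_order all_algebra.
From mathcomp Require Import boolp classical_sets functions cardinality.
From mathcomp Require Import topology.

Set Implicit Arguments.
Unset Strict Implicit.
Unset Printing Implicit Defensive.

Local Open Scope classical_set_scope.
Local Open Scope group_scope.

HB.mixin Record isTopologicalGroup G of Topological G & Group G := {
  mulg_continuous : continuous (fun z : G * G => z.1 * z.2) ;
  invg_continuous : continuous (fun x : G => x^-1)
}.

#[short(type="topGroupType")]
HB.structure Definition TopologicalGroup :=
  {G of Topological G & Group G & isTopologicalGroup G}.

Section ProductGroup.
Variables G H : topGroupType.

Lemma pair_mulg_continuous :
  continuous (fun z : (G * H) * (G * H) => z.1 * z.2).
Proof.
move=> [[a b] [c d]]; apply: cvg_pair => /=.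
  apply: (@cvg_comp _ _ _ (fun z : (G * H) * (G * H) => (z.1.1, z.2.1))
            (fun z : G * G => z.1 * z.2)); last exact: mulg_continuous (a, c).
  apply: cvg_pair; apply: cvg_comp; [exact: cvg_fst|exact: cvg_fst|
    exact: cvg_snd|exact: cvg_fst].
apply: (@cvg_comp _ _ _ (fun z : (G * H) * (G * H) => (z.1.2, z.2.2))
          (fun z : H * H => z.1 * z.2)); last exact: mulg_continuous (b, d).
apply: cvg_pair; apply: cvg_comp; [exact: cvg_fst|exact: cvg_snd|
  exact: cvg_snd|exact: cvg_snd].
Qed.

Lemma pair_invg_continuous : continuous (fun x : G * H => x^-1).
Proof.
move=> [a b]; apply: cvg_pair => /=.
  by apply: cvg_comp; [exact: cvg_fst|exact: (@invg_continuous G a)].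
by apply: cvg_comp; [exact: cvg_snd|exact: (@invg_continuous H b)].
Qed.

HB.instance Definition _ := isTopologicalGroup.Build (G * H)%type
  pair_mulg_continuous pair_invg_continuous.

End ProductGroup.

Section Subgroups.
Variable G : groupType.
Implicit Types (S H N : set G).

Definition is_subgroup H : Prop :=
  [/\ H 1, (forall x y, H x -> H y -> H (x * y))
    & (forall x, H x -> H x^-1)].

Definition is_normal_subgroup N : Prop :=
  is_subgroup N /\ forall x g, N x -> N (x ^ g).

Definition subgroup_gen S : set G := smallest is_subgroup S.

Definition left_cosets H : set (set G) :=
  [set [set g * h | h in H] | g in [set: G]].

End Subgroups.

Section ClosedSubgroups.
Variable G : topGroupType.
Implicit Types (H N : set G).

Definition is_closed_subgroup H : Prop := is_subgroup H /\ closed H.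

Definition is_closed_normal_subgroup N : Prop :=
  is_normal_subgroup N /\ closed N.

Definition topologically_fg H : Prop :=
  exists2 S : set G, finite_set S & H = closure (subgroup_gen S).

End ClosedSubgroups.

Definition is_profinite (G : topGroupType) : Prop :=
  [/\ compact [set: G], hausdorff_space G &
    forall U : set G, nbhs 1 U ->
      exists H : set G, [/\ is_subgroup H, open H & H `<=` U]].

Definition is_pro_p (p : nat) (G : topGroupType) : Prop :=
  is_profinite G /\
  forall N : set G, is_normal_subgroup N -> open N ->
    exists k : nat, (left_cosets N #= `I_(p ^ k)%N)%card.

Section Frattini.
Variables (p : nat) (G : topGroupType).
Implicit Types H K : set G.

Definition power_subgroup H : set G := subgroup_gen [set x ^+ p | x in H].

(* [[~ x, y]] is x^-1 * y^-1 * x * y. *)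
Definition derived_subgroup H : set G :=
  subgroup_gen [set [~ x, y] | x in H & y in H].

Definition frattini H : set G :=
  closure [set x * y | x in power_subgroup H & y in derived_subgroup H].

Definition frattini_resistant : Prop :=
  forall H K, is_closed_subgroup H -> is_closed_subgroup K ->
    topologically_fg H -> topologically_fg K ->
    (frattini H `<=` frattini K <-> H `<=` K).

Definition strongly_frattini_resistant : Prop :=
  forall H K, is_closed_subgroup H -> is_closed_subgroup K ->
    (frattini H `<=` frattini K <-> H `<=` K).

End Frattini.

(* [F] is the free pro-[p] group on the countably infinite set
   [{x 0, x 1, x 2, ...}] converging to [1]. *)
Definition is_free_pro_p (p : nat) (F : topGroupType) (x : nat -> F) : Prop :=
  [/\ is_pro_p p F, x @ \oo --> (1 : F) &
    forall (P : topGroupType) (f : nat -> P),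
      is_pro_p p P -> f @ \oo --> (1 : P) ->
      exists! phi : F -> P,
        [/\ {morph phi : u v / u * v}, continuous phi
          & forall i, phi (x i) = f i]].

(* [pi] identifies [G], as a topological group, with the quotient [F / R]. *)
Definition is_quotient_map (F G : topGroupType) (R : set F) (pi : F -> G) :
    Prop :=
  [/\ {morph pi : u v / u * v}, (forall g, exists u, pi u = g),
      pi @^-1` [set 1] = R
    & forall U : set G, open U <-> open (pi @^-1` U)].

(* The generators are numbered from [0], so that [x i] stands for x_{i+1}:
   the [k]-th partial product is
   x_1^{p^n} [x_1, x_2] [x_3, x_4] ... [x_{2k-1}, x_{2k}]. *)
Definition demushkin_partial (p n : nat) (F : topGroupType) (x : nat -> F)
    (k : nat) : F :=
  x 0%N ^+ (p ^ n)%N * \prod_(i < k) [~ x i.*2, x i.*2.+1].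

(* [G] is the pro-[p] group presented by the generators x_1, x_2, ...
   (converging to [1]) and the single relator [r], the infinite product
   x_1^{p^n} [x_1, x_2] [x_3, x_4] ... *)
Definition is_demushkin_infinite_rank (p n : nat) (G : topGroupType) : Prop :=
  exists (F : topGroupType) (x : nat -> F) (r : F) (pi : F -> G),
    [/\ is_free_pro_p p x,
        demushkin_partial p n x @ \oo --> r
      & is_quotient_map (smallest (@is_closed_normal_subgroup F) [set r]) pi].

(* An element of the inverse limit of the Z/p^k, each class mod p^k being
   represented by its canonical residue [padic_res a k]. *)
Record padic_int (p : nat) : Type := PadicInt {
  padic_res :> nat -> int ;
  padic_resP : forall k,
    padic_res k = (padic_res k.+1 %% (p ^ k)%N)%Z
}.

Section PadicInt.
Variable p : nat.
Implicit Types a b c : padic_int p.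

HB.instance Definition _ := gen_eqMixin (padic_int p).
HB.instance Definition _ := gen_choiceMixin (padic_int p).

Lemma padic_intP a b : (forall k, a k = b k) -> a = b.
Proof.
case: a b => [a Pa] [b Pb] /= /funext eqab.
by case: b / eqab Pb => Pb; congr PadicInt; exact: Prop_irrelevance.
Qed.

Lemma padic_res_mod a k : (a k %% (p ^ k)%N)%Z = a k.
Proof. by rewrite [in LHS]padic_resP modz_mod -padic_resP. Qed.

Lemma modz_expS (m : int) k :
  ((m %% (p ^ k.+1)%N)%Z %% (p ^ k)%N)%Z = (m %% (p ^ k)%N)%Z.
Proof.
rewrite [in RHS](divz_eq m (p ^ k.+1)%N) expnS PoszM GRing.mulrA.
by rewrite modzMDl.
Qed.

Lemma padic_zero_subproof k : 0%Z = (0 %% (p ^ k)%N)%Z.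
Proof. by rewrite mod0z. Qed.

Definition padic_zero : padic_int p := PadicInt padic_zero_subproof.

Lemma padic_add_subproof a b k :
  ((a k + b k)%R %% (p ^ k)%N)%Z
  = (((a k.+1 + b k.+1)%R %% (p ^ k.+1)%N)%Z %% (p ^ k)%N)%Z.
Proof. by rewrite modz_expS (padic_resP a k) (padic_resP b k) modzDm. Qed.

Definition padic_add a b : padic_int p := PadicInt (padic_add_subproof a b).

Lemma padic_opp_subproof a k :
  ((- a k)%R %% (p ^ k)%N)%Z
  = (((- a k.+1)%R %% (p ^ k.+1)%N)%Z %% (p ^ k)%N)%Z.
Proof. by rewrite modz_expS (padic_resP a k) modzNm. Qed.

Definition padic_opp a : padic_int p := PadicInt (padic_opp_subproof a).

Lemma padic_addA : associative padic_add.
Proof.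
by move=> a b c; apply: padic_intP => k /=; rewrite modzDml modzDmr GRing.addrA.
Qed.

Lemma padic_addC : commutative padic_add.
Proof. by move=> a b; apply: padic_intP => k /=; rewrite GRing.addrC. Qed.

Lemma padic_add0 : left_id padic_zero padic_add.
Proof.
by move=> a; apply: padic_intP => k /=; rewrite GRing.add0r padic_res_mod.
Qed.

Lemma padic_addN : left_inverse padic_zero padic_opp padic_add.
Proof.
by move=> a; apply: padic_intP => k /=; rewrite modzDml GRing.addNr mod0z.
Qed.

Lemma padic_addr0 : right_id padic_zero padic_add.
Proof. by move=> a; rewrite padic_addC padic_add0. Qed.

Lemma padic_addrN : right_inverse padic_zero padic_opp padic_add.
Proof. by move=> a; rewrite padic_addC padic_addN. Qed.

(* The group law [*] on [padic_int p] is the addition of p-adic integers. *)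
HB.instance Definition _ := isGroup.Build (padic_int p)
  padic_addA padic_add0 padic_addr0 padic_addN padic_addrN.

(* [padic_ball a k] is the coset [a + p^k Z_p]. *)
Definition padic_ball a (k : nat) : set (padic_int p) := [set b | b k = a k].

Lemma padic_ball_le a k l : (k <= l)%N -> padic_ball a l `<=` padic_ball a k.
Proof.
move=> /subnK <-; elim: (l - k)%N => // m IH b ab; apply: IH.
by rewrite /padic_ball /= (padic_resP a) (padic_resP b) -addSn ab.
Qed.

Definition padic_nbhs a : set_system (padic_int p) :=
  [set A | exists k, padic_ball a k `<=` A].

HB.instance Definition _ := hasNbhs.Build (padic_int p) padic_nbhs.

Lemma padic_nbhs_filter a : ProperFilter (nbhs a).
Proof.
split; first by move=> [k /(_ a)]; apply.
split.
- by exists 0%N.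
- move=> A B [k kA] [l lB]; exists (maxn k l) => b ab; split.
    by apply: kA; exact: padic_ball_le (leq_maxl k l) _ ab.
  by apply: lB; exact: padic_ball_le (leq_maxr k l) _ ab.
- by move=> A B AB [k kA]; exists k; exact: subset_trans kA AB.
Qed.

Lemma padic_nbhs_singleton a (A : set (padic_int p)) : nbhs a A -> A a.
Proof. by move=> [k]; apply. Qed.

Lemma padic_nbhs_nbhs a (A : set (padic_int p)) :
  nbhs a A -> nbhs a (nbhs^~ A).
Proof.
move=> [k kA]; exists k => b ab; exists k => c bc; apply: kA.
by rewrite /padic_ball /= bc.
Qed.

HB.instance Definition _ := Nbhs_isNbhsTopological.Build (padic_int p)
  padic_nbhs_filter padic_nbhs_singleton padic_nbhs_nbhs.

Lemma padic_add_continuous :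
  continuous (fun z : padic_int p * padic_int p => z.1 * z.2).
Proof.
move=> [a b] A [k kA]; exists (padic_ball a k, padic_ball b k).
  by split; exists k.
by move=> [c d] [/= ca db]; apply: kA; rewrite /padic_ball /= ca db.
Qed.

Lemma padic_opp_continuous : continuous (fun a : padic_int p => a^-1).
Proof.
move=> a A [k kA]; exists k => b ab; apply: kA.
by rewrite /padic_ball /= ab.
Qed.

HB.instance Definition _ := isTopologicalGroup.Build (padic_int p)
  padic_add_continuous padic_opp_continuous.

End PadicInt.

(* Main.v *)
(* Resistance amounts to: [y ^+ p] in [frattini p K] implies [y] in [K], for [K]
   topologically finitely generated. In the Demushkin group [G] this holds
   because every continuous homomorphism from a finitely generated closed
   subgroup [H] to [Z/p^k] lifts to [Z/p^(k+1)]. By Shapiro's lemma the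
   obstruction for an open subgroup [V] containing [H] lies in the second
   cohomology of [G] with coefficients in the functions on [G / V]; [G] has
   one relator, so this is a quotient of the functions themselves, and Fox
   calculus shows that it is a quotient of their coinvariants. The
   obstruction therefore dies in any open subgroup of index [p] in [V] that
   contains [H], and one exists since [H], unlike [V], has only finitely many
   characters of order [p]. In [G * Z_p] the problem projects to [G], up to a
   central factor.

   For the failure of strong resistance, let [q = p^n], let [chi : G -> Z/q]
   send [x 0] to 1 and the other generators to 0, and let [K] consist of the
   [(g, t)] with [t = chi g] mod [q]. Since [(x 0, 1)] and the [(x i, 0)] lie
   in [K], the relation of [G] puts [(1, q)] in the Frattini subgroup of [K],
   whereas [(1, q / p)] is not in [K]. *)

Require Import Defs.
From HB Require Import structures.
From mathcomp Require Import all_boot all_order all_algebra.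
From mathcomp Require Import all_fingroup all_solvable.
From mathcomp Require Import finmap.
From mathcomp Require Import boolp classical_sets functions cardinality.
From mathcomp Require Import topology.

Set Implicit Arguments.
Unset Strict Implicit.
Unset Printing Implicit Defensive.

Local Open Scope classical_set_scope.
Local Open Scope group_scope.

(** * Topological groups *)

Section Morphisms.
Variables (G H : groupType) (f : G -> H).
Hypothesis fM : {morph f : u v / u * v}.

Lemma morphism1 : f 1 = 1.
Proof. by apply: (@mulgI _ (f 1)); rewrite -fM !mulg1. Qed.

Lemma morphismV u : f u^-1 = (f u)^-1.
Proof. by apply: (@mulgI _ (f u)); rewrite -fM !mulgV morphism1. Qed.

Lemma morphismX n u : f (u ^+ n) = f u ^+ n.
Proof. by elim: n => [|n IH]; rewrite ?expg0 ?morphism1 // !expgS fM IH. Qed.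

Lemma morphismR u v : f [~ u, v] = [~ f u, f v].
Proof. by rewrite /commg /conjg !fM !morphismV. Qed.

Lemma is_subgroup_preimage (K : set H) :
  is_subgroup K -> is_subgroup (f @^-1` K).
Proof.
case=> K1 KM KV; split=> [|x y|x] /=; first by rewrite morphism1.
  by rewrite fM; exact: KM.
by rewrite morphismV; exact: KV.
Qed.

Lemma is_subgroup_image (K : set G) : is_subgroup K -> is_subgroup (f @` K).
Proof.
case=> K1 KM KV; split; first by exists 1; rewrite ?morphism1.
  by move=> _ _ [x Kx <-] [y Ky <-]; exists (x * y); [exact: KM|exact: fM].
by move=> _ [x Kx <-]; exists x^-1; [exact: KV|exact: morphismV].
Qed.

End Morphisms.

Section Subgroups.
Variable G : groupType.
Implicit Types S K : set G.

Lemma is_subgroupX K x n : is_subgroup K -> K x -> K (x ^+ n).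
Proof.
by case=> K1 KM _ Kx; elim: n => [//|n IH]; rewrite expgS; exact: KM.
Qed.

Lemma is_subgroupR K x y : is_subgroup K -> K x -> K y -> K [~ x, y].
Proof.
case=> K1 KM KV Kx Ky; rewrite commgEl conjgE.
by apply: (KM); [exact: KV|apply: (KM); [exact: KV|exact: KM]].
Qed.

Lemma subgroup_gen_subgroup S : is_subgroup (subgroup_gen S).
Proof.
split=> [K [[]]//|x y Sx Sy K KS|x Sx K KS].
  by case: (KS) => -[_ + _] _; apply; [exact: Sx|exact: Sy].
by case: (KS) => -[_ _ +] _; apply; exact: Sx.
Qed.

Lemma sub_subgroup_gen S : S `<=` subgroup_gen S.
Proof. exact: sub_gen_smallest. Qed.

Lemma subgroup_gen_min S K : is_subgroup K -> S `<=` K -> subgroup_gen S `<=` K.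
Proof. exact: smallest_sub. Qed.

End Subgroups.

Section TopologicalGroups.
Variable G : topGroupType.
Implicit Types (U V K N : set G).

Lemma mulgl_continuous (g : G) : continuous (fun x : G => g * x).
Proof.
move=> x; apply: (@cvg_comp _ _ _ (fun z : G => (g, z))
   (fun z : G * G => z.1 * z.2)); last exact: mulg_continuous (g, x).
by apply: cvg_pair; [exact: cvg_cst|exact: cvg_id].
Qed.

Lemma mulgr_continuous (g : G) : continuous (fun x : G => x * g).
Proof.
move=> x; apply: (@cvg_comp _ _ _ (fun z : G => (z, g))
   (fun z : G * G => z.1 * z.2)); last exact: mulg_continuous (x, g).
by apply: cvg_pair; [exact: cvg_id|exact: cvg_cst].
Qed.

Lemma nbhs1_mul (g : G) U : nbhs 1 U -> nbhs g [set x | U (g^-1 * x)].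
Proof.
by move=> U1; apply: (@mulgl_continuous g^-1 g U); rewrite mulVg.
Qed.

Lemma nbhs_mul1 (g : G) U : nbhs g U -> nbhs 1 [set x | U (g * x)].
Proof.
by move=> Ug; apply: (@mulgl_continuous g 1 U); rewrite mulg1.
Qed.

Lemma expgn_continuous n : continuous (fun x : G => x ^+ n).
Proof.
elim: n => [|n IH] x; first exact: cvg_cst.
rewrite (_ : (fun x => _) = (fun x : G => x * x ^+ n)); last first.
  by apply/funext => y; rewrite expgS.
apply: (@cvg_comp _ _ _ (fun z : G => (z, z ^+ n))
   (fun z : G * G => z.1 * z.2)); last exact: mulg_continuous (x, x ^+ n).
by apply: cvg_pair; [exact: cvg_id|exact: IH].
Qed.

Lemma open_subgroup K : is_subgroup K -> nbhs 1 K -> open K.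
Proof.
move=> [_ KM _] K1; rewrite openE => x Kx; apply: filterS (nbhs1_mul x K1).
by move=> y /(KM _ _ Kx); rewrite mulVKg.
Qed.

Lemma open_subgroup_nbhs1 K : is_subgroup K -> open K -> nbhs 1 K.
Proof. by move=> [K1 _ _] Ko; exact: open_nbhs_nbhs. Qed.

Lemma subgroup_limit K x : is_subgroup K -> nbhs 1 K -> closure K x -> K x.
Proof.
move=> [_ KM KV] K1 /(_ _ (nbhs1_mul x K1)) [y [Ky Kxy]].
by have := KM _ _ Ky (KV _ Kxy); rewrite invgM invgK mulVKg.
Qed.

Lemma closed_open_subgroup K : is_subgroup K -> open K -> closed K.
Proof. by move=> sK oK x; exact: subgroup_limit (open_subgroup_nbhs1 sK oK).
  Qed.

Lemma closure_subgroup K : is_subgroup K -> is_subgroup (closure K).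
Proof.
move=> [K1 KM KV]; split; first exact: subset_closure.
- move=> x y Kx Ky A /(mulg_continuous (x, y)) [[B C] /= [xB yC] BCA].
  have [b [Kb Bb]] := Kx _ xB; have [c [Kc Cc]] := Ky _ yC.
  by exists (b * c); split; [exact: KM|exact: (BCA (b, c))].
- move=> x Kx A /(invg_continuous x) xA; have [b [Kb Ab]] := Kx _ xA.
  by exists b^-1; split => //; exact: KV.
Qed.

Lemma closure_image (H : topGroupType) (f : G -> H) K :
  continuous f -> f @` closure K `<=` closure (f @` K).
Proof.
move=> fc _ [x Kx <-] A /(fc x) fA; have [y [Ky Ay]] := Kx _ fA.
by exists (f y); split => //; exists y.
Qed.

End TopologicalGroups.

Lemma nbhs1_conj (G : topGroupType) (U : set G) (t : G) :
  nbhs 1 U -> nbhs 1 [set x | U (x ^ t)].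
Proof.
move=> U1; have : nbhs (1 ^ t) U by rewrite conj1g.
move=> /(@mulgl_continuous G t^-1 (1 * t)) /(@mulgr_continuous G t 1).
exact.
Qed.

(** The action on the left cosets of [V], finite in number by compactness. Permutations compose from
    left to right, so [g] has to send the coset of [h] to that of [g^-1 * h]. *)
Lemma coset_action (G : topGroupType) (V : set G) :
  compact [set: G] -> is_subgroup V -> open V ->
  exists (T : finType) (o : T) (rho : G -> {perm T}),
    [/\ {morph rho : u v / u * v}, nbhs 1 [set g | rho g = 1],
        (forall g, V g <-> rho g o = o),
        (forall i, exists g, rho g o = i)
      & (left_cosets V #= `I_#|T|)%card].
Proof.
move=> Gc sV oV; have [V1 VM VV] := sV.
pose cos g : set G := [set g * h | h in V].
have cosP g x : cos g x <-> V (g^-1 * x).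
  split=> [[h Vh <-]|Vgx]; first by rewrite mulKg.
  by exists (g^-1 * x); rewrite ?mulVKg.
have eq_cos g h : V (g^-1 * h) -> cos g = cos h.
  move=> Vgh; apply/seteqP; split=> x /cosP Vx; apply/cosP.
    by have := VM _ _ (VV _ Vgh) Vx; rewrite invgM invgK -mulgA mulVKg.
  by have := VM _ _ Vgh Vx; rewrite -mulgA mulVKg.
have Cfin : finite_set (left_cosets V).
  pose pG : ptopologicalType := HB.pack_for ptopologicalType G
    (isPointed.Build G 1).
  have : @cover_compact pG [set: pG] by rewrite -compact_cover; exact: Gc.
  move=> /(_ G [set: G] cos).
  case=> [g _|g _|D _ GD].
  - rewrite (_ : cos g = (fun x => g^-1 * x) @^-1` V).
      by apply: open_comp oV => x _; exact: mulgl_continuous.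
    by apply/seteqP; split=> x /cosP.
  - by exists g => //; apply/cosP; rewrite mulVg.
  apply: (@sub_finite_set _ _ (cos @` [set` D])); last exact: finite_image.
  move=> _ [g _ <-]; have [h Dh /cosP hg] := GD g I.
  by exists h => //; exact: eq_cos.
pose T : finType := fset_set (left_cosets V).
have memT g : cos g \in fset_set (left_cosets V).
  by rewrite in_fset_set // inE; exists g.
pose el g : T := [` memT g]%fset.
have elE g h : el g = el h <-> V (g^-1 * h).
  split=> [[/= /(congr1 (fun A => A h)) E]|Vgh]; last exact/val_inj/eq_cos.
  by apply/cosP; rewrite E; apply/cosP; rewrite mulVg.
have elS (i : T) : exists g, el g = i.
  have := fsvalP i; rewrite in_fset_set // inE => -[g _ gi].
  by exists g; apply: val_inj.
pose rep i : G := projT1 (cid (elS i)).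
have repK i : el (rep i) = i by rewrite /rep; case: cid.
pose act g (i : T) : T := el (g^-1 * rep i).
have actE g h : act g (el h) = el (g^-1 * h).
  have /elE Vr := repK (el h).
  by apply/elE; rewrite invgM invgK -mulgA mulVKg.
have act_inj g : injective (act g).
  move=> i j; rewrite -(repK i) -(repK j) !actE => /elE.
  by rewrite invgM invgK -mulgA mulVKg => /elE.
pose rho g : {perm T} := perm (act_inj g).
have rhoM : {morph rho : u v / u * v}.
  move=> u v; apply/permP => i; rewrite permM !permE -(repK i) !actE.
  by rewrite invgM mulgA.
have stab g : V g <-> rho g (el 1) = el 1.
  rewrite permE actE mulg1; split=> [Vg|/elE].
    by apply/elE; rewrite invgK mulg1.
  by rewrite invgK mulg1.
have trans i : exists g, rho g (el 1) = i.
  by exists (rep i)^-1; rewrite permE actE invgK mulg1 repK.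
exists T, (el 1), rho; split => //; last first.
  by have /finite_setP[m Cm] := Cfin; rewrite -cardfE (card_fset_set Cm).
have V1n := open_subgroup_nbhs1 sV oV.
(* The kernel is an intersection of conjugates of [V], one for each of the finitely many cosets. *)
suff : \forall g \near (1 : G), forall i, rho g i = i.
  by apply: filterS => g gi; apply/permP => i; rewrite gi perm1.
apply: filter_forall => i; have [t <-] := trans i.
apply: filterS (nbhs1_conj t^-1 V1n) => g /= /stab.
by rewrite conjgE invgK !rhoM !permM (morphismV rhoM) => /(canRL (permKV _)).
Qed.

(** * Finite quotients of profinite groups *)

Lemma pgroup_exponent (p : nat) (gT : finGroupType) (P : {group gT}) :
  prime p -> {in P, forall x, exists k, x ^+ (p ^ k) = 1} -> p.-group P.
Proof.
move=> p_pr PX; apply/pgroupP => q q_pr /(Cauchy q_pr) [x Px ox].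
have [k xk] := PX x Px; have : (q %| p ^ k)%N by rewrite -ox order_dvdn xk.
by rewrite Euclid_dvdX // dvdn_prime2 // inE => /andP[].
Qed.

Section FiniteImage.
Variables (G : groupType) (gT : finGroupType) (f : G -> gT).

Definition fimage (K : set G) : {set gT} := [set x | `[< (f @` K) x >]]%SET.

Lemma fimageP (K : set G) x : reflect (exists2 g, K g & f g = x) (x \in fimage
  K).
Proof. by rewrite inE; exact: asboolP. Qed.

Lemma mem_fimage (K : set G) g : K g -> f g \in fimage K.
Proof. by move=> Kg; apply/fimageP; exists g. Qed.

Hypothesis fM : {morph f : u v / u * v}.

Lemma fimage_group_set (K : set G) : is_subgroup K -> group_set (fimage K).
Proof.
move=> /(is_subgroup_image fM) [K1 KM _].
apply/group_setP; split; first exact/fimageP.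
by move=> x y /fimageP Kx /fimageP Ky; apply/fimageP; exact: KM.
Qed.

End FiniteImage.

Lemma is_subgroupT (G : groupType) : is_subgroup [set: G].
Proof. by []. Qed.

Section Kernel.
Variables (G : topGroupType) (gT : groupType) (f : G -> gT).
Hypothesis fM : {morph f : u v / u * v}.

Lemma kernel_normal : is_normal_subgroup (f @^-1` [set 1]).
Proof.
split; first by apply: is_subgroup_preimage => //;
  split=> [|x y -> ->|x ->] //=;
  rewrite ?mulg1 ?invg1.
by move=> x g /= fx; rewrite conjgE !fM (morphismV fM) fx mul1g mulVg.
Qed.

Hypothesis f1 : nbhs 1 [set g | f g = 1].

Lemma open_kernel : open (f @^-1` [set 1]).
Proof. by apply: open_subgroup => //; case: kernel_normal. Qed.

Lemma nbhs_locally_constant g : nbhs g [set x | f x = f g].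
Proof.
apply: filterS (nbhs1_mul g f1) => x /=.
by rewrite fM (morphismV fM) => /mulg1_eq <-; rewrite invgK.
Qed.

End Kernel.

(** As [N] is normal, it is the kernel of the coset action and the image acts regularly, so the
    order of the image is the number of cosets. *)
Lemma coset_action_normal (G : topGroupType) (N : set G) :
  compact [set: G] -> is_normal_subgroup N -> open N ->
  exists (gT : finGroupType) (f : G -> gT),
    [/\ {morph f : u v / u * v}, f @^-1` [set 1] = N &
      (left_cosets N #= `I_#|fimage f setT|)%card].
Proof.
move=> Gc [sN nN] oN.
have [T [o [rho [rhoM _ stab trans cardT]]]] := coset_action Gc sN oN.
have kerE g : N g <-> rho g = 1.
  split=> [Ng|rg]; last by apply/stab; rewrite rg perm1.
  apply/permP => i; have [t <-] := trans i; rewrite perm1 -permM -rhoM.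
  have /stab : N (g ^ t^-1) by exact: nN.
  by rewrite conjgE invgK !rhoM permM (morphismV rhoM) !permM => /(canRL (permKV
    _)).
exists {perm T}, rho; split=> //; first by apply/seteqP; split=> g /kerE.
pose Q := group (fimage_group_set rhoM (@is_subgroupT G)).
suff <- : #|T| = #|Q| by [].
have := card_orbit_stab 'P Q o.
rewrite (_ : orbit 'P Q o = [set: T]%SET); last first.
  apply/setP => i; rewrite inE; have [g <-] := trans i.
  by apply/orbitP; exists (rho g) => //; exact: mem_fimage.
rewrite (_ : 'C_Q[o | 'P]%g = 1) ?cardsT ?cards1 ?muln1 //.
apply/trivgP/fintype.subsetP => x /setIP[/fimageP[g _ <-]] /astab1P /stab /kerE
  ->.
exact: group1.
Qed.

Lemma pro_p_power (p : nat) (G : topGroupType) (N : set G) (g : G) :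
  is_pro_p p G -> is_normal_subgroup N -> open N -> exists k, N (g ^+ (p ^ k)).
Proof.
move=> [[Gc _ _] pG] nN oN; have [k cN] := pG N nN oN.
have [gT [f [fM kerf cf]]] := coset_action_normal Gc nN oN.
exists k; rewrite -kerf /= (morphismX fM).
have <- : #|fimage f setT| = (p ^ k)%N.
  by apply/card_eq_II; apply: card_eq_trans cN; rewrite card_eq_sym.
apply: (expg_cardG (G := group (fimage_group_set fM (@is_subgroupT G)))).
exact: mem_fimage.
Qed.

(** Converse of [pro_p_power], by Cauchy's theorem. The condition on powers is easier to check for
    quotients and products than the count of cosets. *)
Lemma is_pro_pP (p : nat) (G : topGroupType) : prime p -> is_profinite G ->
  (forall (N : set G) (g : G), is_normal_subgroup N -> open N -> exists k, N (g
    ^+ (p ^ k))) ->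
  is_pro_p p G.
Proof.
move=> p_pr Gp GX; split=> // N nN oN; have [Gc _ _] := Gp.
have [gT [f [fM kerf cf]]] := coset_action_normal Gc nN oN.
pose Q := group (fimage_group_set fM (@is_subgroupT G)).
exists (logn p #|Q|); rewrite -card_pgroup //; apply: pgroup_exponent => //.
move=> _ /fimageP[g _ <-]; have [k] := GX N g nN oN.
by rewrite -kerf /= (morphismX fM); exists k.
Qed.

Lemma pgroup_fimage (p : nat) (G : topGroupType) (gT : finGroupType)
    (f : G -> gT) (P : {group gT}) : prime p -> is_pro_p p G ->
  {morph f : u v / u * v} -> nbhs 1 [set g | f g = 1] ->
  P \subset fimage f setT -> p.-group P.
Proof.
move=> p_pr pG fM f1 sP; apply: pgroup_exponent => // x.
move=> /(fintype.subsetP sP) /fimageP[g _ <-].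
have [k fk] := pro_p_power g pG (kernel_normal fM) (open_kernel fM f1).
by exists k; rewrite -(morphismX fM).
Qed.

(** Some coset of an open [V] contains [x] and misses [K]; an equality [rho x = rho k] in the coset
    action would put [k] into it. *)
Lemma separate_closed_subgroup (G : topGroupType) (K : set G) (x : G) :
  is_profinite G -> closed K -> ~ K x ->
  exists (T : finType) (rho : G -> {perm T}),
    [/\ {morph rho : u v / u * v}, nbhs 1 [set g | rho g = 1]
      & rho x \notin fimage rho K].
Proof.
move=> [Gc _ Gb] cK nKx.
have /nbhs_mul1 /Gb [V [sV oV sub]] : nbhs x (~` K).
  by apply: open_nbhs_nbhs; split=> //; exact: closed_openC.
have [T [o [rho [rhoM rho1 stab _ _]]]] := coset_action Gc sV oV.
exists T, rho; split=> //; apply/fimageP => -[k Kk rk].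
apply: (sub (x^-1 * k)); last by rewrite mulVKg.
by apply/stab; rewrite rhoM (morphismV rhoM) rk mulVg perm1.
Qed.

(** * Free pro-p groups *)

(** A finite group as a topological group, to serve as a target in the universal property of free
    pro-[p] groups. *)
Definition discrete_group (gT : finGroupType) : Type := discrete_topology gT.

Section DiscreteGroup.
Variable gT : finGroupType.

HB.instance Definition _ :=
  DiscreteTopology.copy (discrete_group gT) (discrete_topology gT).
HB.instance Definition _ := Group.copy (discrete_group gT) gT.

Lemma discrete_mulg_continuous :
  continuous (fun z : discrete_group gT * discrete_group gT => z.1 * z.2).
Proof.
move=> [a b] A /nbhs_singleton Aab; exists ([set a], [set b]).
  by split; exact: discrete_set1.
by move=> [c d] [/= -> ->].
Qed.

Lemma discrete_invg_continuous :
  continuous (fun x : discrete_group gT => x^-1).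
Proof.
move=> a A /nbhs_singleton Aa.
rewrite nbhs_principalE; exact/principal_filterP.
Qed.

HB.instance Definition _ := isTopologicalGroup.Build (discrete_group gT)
  discrete_mulg_continuous discrete_invg_continuous.

Lemma discrete_group_pro_p (p : nat) : prime p -> p.-group [set: gT]%SET ->
  is_pro_p p (discrete_group gT).
Proof.
move=> p_pr pgT; apply: is_pro_pP => //.
  split; first exact/finite_compact/(@finite_finset gT).
    exact: discrete_hausdorff.
  move=> U /nbhs_singleton U1; exists [set 1]; split; last by move=> _ ->.
    by split=> [//|x y -> ->|x ->]; rewrite /= ?mulg1 ?invg1.
  exact: discrete_open.
move=> N g [[N1 _ _] _] _; exists (logn p #|[set: gT]%SET|).
rewrite -card_pgroup //; suff -> : g ^+ #|[set: gT]%SET| = 1 by [].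
exact: (@expg_cardG gT [set: gT]%G g (finset.in_setT _)).
Qed.

End DiscreteGroup.

Lemma pgroup_subg (p : nat) (gT : finGroupType) (P : {group gT}) :
  p.-group P -> p.-group [set: subg_of P]%SET.
Proof. by rewrite /pgroup cardsT card_sub; apply: etrans; congr pnat. Qed.

Section FreeProP.
Variables (p : nat) (F : topGroupType) (x : nat -> F).
Hypotheses (p_pr : prime p) (Fx : is_free_pro_p p x).

(** The universal property at [subg_of P]; in this form the target can be a [p]-group inside a
    symmetric group. *)
Lemma free_pro_p_lift (gT : finGroupType) (P : {group gT}) (f : nat -> gT) :
  p.-group P -> (forall i, f i \in P) -> (\forall i \near \oo, f i = 1) ->
  exists phi : F -> gT,
    [/\ {morph phi : u v / u * v}, nbhs 1 [set u | phi u = 1],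
        forall i, phi (x i) = f i & forall u, phi u \in P].
Proof.
move=> pP fP f1; have [_ _ univ] := Fx.
pose g i : discrete_group (subg_of P) := subg P (f i).
have [||phi [[phiM phic phix] _]] := univ (discrete_group (subg_of P)) g.
- by apply: discrete_group_pro_p => //; exact: pgroup_subg.
- apply/discrete_cvg; apply: filterS f1 => i fi.
  by rewrite /= /g fi; apply: val_inj; rewrite /= subgK ?group1.
exists (fun u => sgval (phi u)); split=> [u v||i|u]; last exact: subgP.
- by rewrite phiM.
- have phi1 : nbhs 1 [set u | phi u = phi 1] := phic 1 _ (discrete_set1 (phi
    1)).
  by apply: filterS phi1 => u /= ->; rewrite (morphism1 phiM).
- by rewrite phix subgK.
Qed.

Lemma free_pro_p_hom_unique (gT : finGroupType) (P : {group gT})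
    (f g : F -> gT) : p.-group P ->
  {morph f : u v / u * v} -> nbhs 1 [set u | f u = 1] ->
  {morph g : u v / u * v} -> nbhs 1 [set u | g u = 1] ->
  (forall u, f u \in P) -> (forall u, g u \in P) ->
  (forall i, f (x i) = g (x i)) -> f =1 g.
Proof.
move=> pP fM f1 gM g1 fP gP fg; have [_ x1 univ] := Fx.
pose toP (h : F -> gT) u : discrete_group (subg_of P) := subg P (h u).
have toPM (h : F -> gT) : {morph h : u v / u * v} -> (forall u, h u \in P) ->
    {morph toP h : u v / u * v}.
  by move=> hM hP u v; apply: val_inj; rewrite /= !subgK ?hM //; rewrite -?hM.
have toPc (h : F -> gT) : {morph h : u v / u * v} -> nbhs 1 [set u | h u = 1] ->
    continuous (toP h).
  move=> hM h1 u A /nbhs_singleton Au.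
  suff : nbhs u (toP h @^-1` A) by [].
  apply: filterS (nbhs_locally_constant hM h1 u) => v /= hv.
  by rewrite /toP hv.
have [||phi [_ uniq]] := univ (discrete_group (subg_of P)) (toP f \o x).
- by apply: discrete_group_pro_p => //; exact: pgroup_subg.
- have fx1 : \forall i \near \oo, f (x i) = 1 := x1 _ f1.
  apply/discrete_cvg; apply: filterS fx1 => i /= fi.
  by rewrite /toP fi; apply: val_inj; rewrite /= subgK ?group1.
have ef : phi = toP f by apply: uniq; split; [exact: toPM|exact: toPc|].
have eg : phi = toP g.
  by apply: uniq; split; [exact: toPM|exact: toPc|move=> i; rewrite /= /toP fg].
move=> u; have := congr1 (fun h => sgval (h u)) (etrans (esym ef) eg).
by rewrite /= !subgK.
Qed.

(** Let [P] be the image of [F] acting on the cosets of [S], and [Q] the stabiliser in [P] of the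
    base coset. The generators map into [Q]; by uniqueness [rho] equals the lift through [Q], so [F]
    fixes the base coset. *)
Lemma free_pro_p_generated (S : set F) :
  is_subgroup S -> nbhs 1 S -> (forall i, S (x i)) -> S = setT.
Proof.
move=> sS S1 Sx; apply/seteqP; split=> // u _.
have [pF x1 _] := Fx; have [[Fc _ _] _] := pF.
have oS := open_subgroup sS S1.
have [T [o [rho [rhoM rho1 stab _ _]]]] := coset_action Fc sS oS.
pose P := group (fimage_group_set rhoM (@is_subgroupT F)).
have pP : p.-group P by exact: (pgroup_fimage p_pr pF rhoM rho1).
pose Q := ('C_P[o | 'P])%G.
have [|||phi [phiM phi1 phix phiQ]] := @free_pro_p_lift _ Q (rho \o x).
- exact: pgroupS (subsetIl _ _) pP.
- move=> i; apply/setIP; split; first exact: mem_fimage.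
  by apply/astab1P; exact/stab.
- exact: x1 _ rho1.
apply/stab; rewrite -(@free_pro_p_hom_unique _ P phi rho) //.
- by have /setIP[_ /astab1P] := phiQ u.
- by move=> v; have /setIP[] := phiQ v.
- by move=> v; exact: mem_fimage.
Qed.

End FreeProP.

Import GRing.Theory.

Bind Scope group_scope with TopologicalGroup.sort.

(** * Derivations and the Demushkin relator *)

Definition group_action (F : groupType) (M : zmodType) (act : F -> M -> M) :=
  [/\ forall u, act 1 u = u, forall g h u, act (g * h) u = act g (act h u)
    & forall g u v, act g (u + v)%R = (act g u + act g v)%R].

Definition derivation (F : groupType) (M : zmodType) (act : F -> M -> M)
    (D : F -> M) :=
  forall g h, D (g * h) = (D g + act g (D h))%R.

Section Derivations.
Variables (F : groupType) (M : zmodType) (act : F -> M -> M).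
Hypothesis actP : group_action act.

Lemma gact1 u : act 1 u = u. Proof. by case: actP. Qed.
Lemma gactM g h u : act (g * h) u = act g (act h u). Proof. by case: actP. Qed.
Lemma gactD g u v : act g (u + v)%R = (act g u + act g v)%R.
Proof. by case: actP. Qed.
Lemma gact0 g : act g 0%R = 0%R.
Proof. by apply: (@addrI _ (act g 0%R)); rewrite -gactD !addr0. Qed.
Lemma gactN g u : act g (- u)%R = (- act g u)%R.
Proof. by apply: (@addrI _ (act g u)); rewrite -gactD !subrr gact0. Qed.
Lemma gactB g u v : act g (u - v)%R = (act g u - act g v)%R.
Proof. by rewrite gactD gactN. Qed.
Lemma gactMn g u m : act g (u *+ m)%R = (act g u *+ m)%R.
Proof. by elim: m => [|m IH]; rewrite ?gact0 // !mulrS gactD IH. Qed.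
Lemma gactK g u : act g^-1 (act g u) = u.
Proof. by rewrite -gactM mulVg gact1. Qed.

Variable D : F -> M.
Hypothesis derD : derivation act D.

Lemma derivation1 : D 1 = 0%R.
Proof. by apply: (@addrI _ (D 1));
  rewrite -{2}(gact1 (D 1)) -derD mulg1 addr0. Qed.

Lemma derivationV g : D g^-1 = (- act g^-1 (D g))%R.
Proof. by apply/eqP; rewrite -addr_eq0 -derD mulVg derivation1. Qed.

(** Fox calculus: the coefficients of [D a] and [D b] are a^-1 (b^-1 - 1) and a^-1 b^-1 (a - 1). *)
Lemma derivationR a b : D [~ a, b] =
  (act a^-1 (act b^-1 (D a) - D a) + act a^-1 (act b^-1 (act a (D b) - D b)))%R.
Proof.
rewrite commgEl conjgE !derD !derivationV !gactD !gactN.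
by rewrite [in RHS]addrACA [LHS]addrA [LHS]addrC.
Qed.

Lemma derivationX g m : D (g ^+ m) = (\sum_(l < m) act (g ^+ l) (D g))%R.
Proof.
elim: m => [|m IH]; first by rewrite big_ord0 derivation1.
by rewrite expgSr derD IH big_ord_recr.
Qed.

End Derivations.

Lemma derivation_locally_constant (F : topGroupType) (M : zmodType)
    (act : F -> M -> M) (D : F -> M) :
  group_action act -> derivation act D -> nbhs 1 [set g | D g = 0%R] ->
  forall g, nbhs g [set h | D h = D g].
Proof.
move=> actP derD D1 g; apply: filterS (nbhs1_mul g D1) => h /= Dgh.
by rewrite -(mulVKg g h) derD Dgh gact0 // addr0.
Qed.

(** Bookkeeping for [S_first], where [N] is the norm of [u], and [A], [X], [Y], [C] are a^q u, a^q
    a^-1 b^-1 a u, a^q a^-1 b^-1 u and a^q a^-1 u. *)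
Lemma Fox_combination (V : zmodType) (N A X Y C u : V) :
  ((N + A - u + (X - A)) - (N + (Y - C)) - (X - Y) = C - u)%R.
Proof.
rewrite (addrAC N A) -(addrA (N - u)%R) (addrC A) subrK (addrC N) (addrAC (-
  u)%R).
rewrite addrKA !opprB -addrA subrKA -addrA (addrC X) subrK; exact: addrC.
Qed.

(* [B] is the group of values at the relator [r] of the [p]-torsion derivations.
   Fox calculus on the block [~ a, b] of [r] shows that [B] contains [g u - u]
   for [g = a, b] once it does so for the generators preceding the block;
   thus [B] contains the whole augmentation of the [p]-torsion of [M]. *)
Section DemushkinRelator.
Variables (p n : nat) (F : topGroupType) (x : nat -> F) (r : F).
Variables (M : zmodType) (act : F -> M -> M).
Hypotheses (p_pr : prime p) (n_gt0 : (0 < n)%N) (actP : group_action act).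
Hypothesis act1 : nbhs 1 [set g | forall u, act g u = u].
Hypothesis actX : exists e, forall u, act (x 0%N ^+ (p ^ e)) u = u.
Hypothesis xr : demushkin_partial p n x @ \oo --> r.
Hypothesis generated : forall S : set F,
  is_subgroup S -> nbhs 1 S -> (forall i, S (x i)) -> S = setT.

Definition torsion_derivation (D : F -> M) :=
  [/\ derivation act D, nbhs 1 [set g | D g = 0%R]
    & forall g, (D g *+ p = 0)%R].

Definition relator_values (m : M) := exists2 D, torsion_derivation D & D r = m.
Local Notation B := relator_values.

Lemma relator_values0 : B 0%R.
Proof.
exists (fun=> 0%R) => //; split=> [g h||g]; last by rewrite mul0rn.
  by rewrite gact0 ?addr0.
exact: nearW.
Qed.

Lemma relator_valuesB u v : B u -> B v -> B (u - v)%R.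
Proof.
move=> [D [dD D1 Dp] <-] [E [dE E1 Ep] <-].
exists (fun g => D g - E g)%R => //; split=> [g h||g].
- by rewrite dD dE (gactB actP) opprD addrACA.
- by apply: filterS2 D1 E1 => g /= -> ->; rewrite subrr.
- by rewrite mulrnBl Dp Ep subrr.
Qed.

Lemma relator_valuesN u : B u -> B (- u)%R.
Proof. by rewrite -(sub0r u); apply: relator_valuesB relator_values0. Qed.

Lemma relator_valuesD u v : B u -> B v -> B (u + v)%R.
Proof. by move=> Bu /relator_valuesN; rewrite -{2}(opprK v);
  exact: relator_valuesB. Qed.

Lemma relator_values_sum (I : Type) (s : seq I) (f : I -> M) :
  (forall i, B (f i)) -> B (\sum_(i <- s) f i)%R.
Proof.
move=> Bf; elim: s => [|i s IH]; first by rewrite big_nil;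
  exact: relator_values0.
by rewrite big_cons; exact: relator_valuesD.
Qed.

Hypothesis derivation_extension : forall f : nat -> M,
  (\forall i \near \oo, f i = 0%R) -> (forall i, f i *+ p = 0)%R ->
  exists2 D, torsion_derivation D & forall i, D (x i) = f i.

(** [S] turns out to be a subgroup and a neighbourhood of [1], so [generated] reduces [S = setT] to
    the generators [x i]. *)
Let S (g : F) := forall u, (u *+ p = 0)%R -> B (act g u - u)%R.

Let act_torsion g u : (u *+ p = 0 -> act g u *+ p = 0)%R.
Proof. by move=> up; rewrite -gactMn // up gact0. Qed.

Let S_subgroup : is_subgroup S.
Proof.
split=> [u _|g h Sg Sh u up|g Sg u up].
- by rewrite gact1 // subrr; exact: relator_values0.
- rewrite gactM // -(subrKA (act h u)); apply: relator_valuesD; last exact: Sh.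
  by apply: Sg; exact: act_torsion.
- have /relator_valuesN := Sg _ (act_torsion g^-1 up).
  by rewrite -gactM // mulgV gact1 // opprB.
Qed.

Let S_nbhs : nbhs 1 S.
Proof.
by apply: filterS act1 => g gu u _; rewrite gu subrr; exact: relator_values0.
Qed.

Let S_cancel g u : S g -> (u *+ p = 0)%R -> B (act g u) -> B u.
Proof.
move=> Sg up Bg; rewrite -(subKr (act g u) u); apply: relator_valuesB => //.
exact: Sg.
Qed.

Let block (a b : F) :
  (forall u, u *+ p = 0 -> B (act a^-1 (act b^-1 u - u)))%R ->
  (forall u, u *+ p = 0 -> B (act a^-1 (act b^-1 (act a u - u))))%R ->
  S a /\ S b.
Proof.
move=> Ha Hb; have SaV : S a^-1.
  (* [Ha] at [act a u], minus [Ha] at [u], minus [Hb] at [u], telescopes to [act a^-1 u - u]. *)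
  move=> u up; have aup := act_torsion a up.
  have := relator_valuesN (Hb _ up); have := relator_valuesN (Ha _ up).
  rewrite !(gactB actP) !opprB => B1 B2.
  have := relator_valuesD B2 (Ha _ aup).
  rewrite !(gactB actP) (gactK actP) subrKA => /(relator_valuesD B1).
  by rewrite subrKA.
have Sa : S a by rewrite -(invgK a); case: S_subgroup => _ _; apply.
split=> //; suff SbV : S b^-1 by rewrite -(invgK b); case: S_subgroup => _ _;
  apply.
move=> u up; apply: (S_cancel SaV); last exact: Ha.
by rewrite mulrnBl up act_torsion // subrr.
Qed.

Let D_stable D k m : torsion_derivation D -> (k <= m)%N ->
  (forall i, (k.*2 <= i)%N -> D (x i) = 0%R) ->
  D (demushkin_partial p n x m) = D (demushkin_partial p n x k).
Proof.
move=> [dD _ _] /subnK <- Dx; elim: (m - k)%N => [//|l IH].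
rewrite /demushkin_partial addSn big_ord_recr /= mulgA dD -/(demushkin_partial _
  _ _ _) IH.
rewrite (derivationR actP dD) !Dx ?leq_double ?leq_addl //; last first.
  by rewrite (leq_trans _ (leqnSn _)) // leq_double leq_addl.
by rewrite !(gact0 actP, subr0, addr0).
Qed.

(** [D] is locally constant, so its value at the infinite product is its value at a late partial
    product, and the blocks from [k] on contribute nothing. *)
Let D_relator D k : torsion_derivation D ->
  (forall i, (k.*2 <= i)%N -> D (x i) = 0%R) ->
  D r = D (demushkin_partial p n x k).
Proof.
move=> tD Dx; have [dD D1 _] := tD.
have Dr := xr (derivation_locally_constant actP dD D1 r).
have [N _ /(_ (maxn N k))] : \forall j \near \oo, D (demushkin_partial p n x j)
  = D r.
  exact: Dr.
by rewrite /= leq_maxl => /(_ isT) <-; rewrite (D_stable tD _ Dx) ?leq_maxr.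
Qed.

Let single j u : (u *+ p = 0)%R ->
  exists2 D, torsion_derivation D & forall i, D (x i) = if i == j then u else
    0%R.
Proof.
move=> up; apply: derivation_extension.
  exists j.+1 => // i /= ji; case: eqP => // ij.
  by rewrite ij ltnn in ji.
by move=> i; case: eqP => _ //; rewrite mul0rn.
Qed.

Let D_initial D k : torsion_derivation D -> (0 < k)%N ->
  (forall i, (i < k.*2)%N -> D (x i) = 0%R) ->
  D (demushkin_partial p n x k) = 0%R.
Proof.
move=> [dD _ _] k_gt0 Dx; rewrite dD (derivationX actP dD) big1 => [|i _];
  last first.
  by rewrite Dx ?double_gt0 // (gact0 actP).
rewrite add0r; elim: {-2}k (leqnn k) => [|l IH] lk.
  by rewrite big_ord0 (derivation1 actP dD) (gact0 actP).
have l2k : (l.*2.+1 < k.*2)%N by rewrite -doubleS leq_double.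
rewrite big_ord_recr /= dD (gactD actP) IH ?(ltnW lk) // add0r (derivationR actP
  dD).
by rewrite !Dx // ?(ltnW l2k) // !(gact0 actP, subr0, addr0).
Qed.

Let D_block D k : torsion_derivation D ->
  (forall i, (k.+1.*2 <= i)%N -> D (x i) = 0%R) ->
  D r = (D (demushkin_partial p n x k) +
    act (demushkin_partial p n x k) (D [~ x k.*2, x k.*2.+1])%g)%R.
Proof.
by move=> tD /(D_relator tD) ->; have [dD _ _] := tD;
  rewrite /demushkin_partial big_ord_recr /= mulgA dD.
Qed.

(* In the first block, whose relator also contains [a ^+ q], the argument only
   gives [a ^+ (q - 1)]; as [q - 1] is prime to [p], this suffices. *)
Let S_first : S (x 0%N) /\ S (x 1%N).
Proof.
set a := x 0%N; set b := x 1%N; set q := (p ^ n)%N.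
have Hb u : (u *+ p = 0)%R -> B (act (a ^+ q) (act a^-1 (act b^-1 (act a u -
  u)))).
  move=> up; have [D tD Dx] := single 1%N up; exists D => //;
    have [dD _ _] := tD.
  rewrite (@D_block D 0%N) //=; last by move=> [|[|i]] // _; rewrite Dx.
  rewrite /demushkin_partial big_ord0 mulg1 (derivationX actP dD).
  rewrite (derivationR actP dD) !Dx /= big1 ?add0r => [|i _];
    last by rewrite (gact0 actP).
  by rewrite !(gact0 actP, subr0, add0r).
(* The Fox derivative of [a ^+ q], applied to [u]. *)
pose N u := (\sum_(l < q) act (a ^+ l) u)%R.
have Ha u : (u *+ p = 0)%R -> B (N u + act (a ^+ q) (act a^-1 (act b^-1 u -
  u)))%R.
  move=> up; have [D tD Dx] := single 0%N up; exists D => //;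
    have [dD _ _] := tD.
  rewrite (@D_block D 0%N) //=; last by move=> [|[|i]] // _; rewrite Dx.
  rewrite /demushkin_partial big_ord0 mulg1 (derivationX actP dD).
  rewrite (derivationR actP dD) !Dx /=.
  by rewrite !(gact0 actP, subr0, addr0).
have NS u : (N (act a u) = N u + act (a ^+ q) u - u)%R.
  apply: (addrI u); rewrite [RHS]addrC subrK /N.
  rewrite -(big_ord_recr q (fun l => act (a ^+ l) u)) big_ord_recl expg0 (gact1
    actP).
  by congr (_ + _)%R; apply: eq_bigr => i _; rewrite -(gactM actP) -expgSr.
have Sq : S (a ^+ q * a^-1).
  move=> u up; have aup := act_torsion a up.
  have := relator_valuesB (relator_valuesB (Ha _ aup) (Ha _ up)) (Hb _ up).
  rewrite NS !(gactB actP) (gactK actP) Fox_combination -(gactM actP); exact.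
have q_gt0 : (0 < q)%N by rewrite expn_gt0 prime_gt0.
have [_ SM SV] := S_subgroup.
have Sa : S a.
  have [e ae] := actX.
  (* This power acts trivially because p^e divides q^e, and q^e - 1 is a multiple of q - 1; so [S]
     contains two consecutive powers of [a]. *)
  have Sae : S (a ^+ (q ^ e)).
    rewrite /q -expnM -(subnK (leq_pmull e n_gt0)) addnC expnD expgnA.
    apply: (is_subgroupX (K := S)) => // u _.
    by rewrite ae subrr; exact: relator_values0.
  have /dvdnP[m qm] := dvdn_pred_predX q e.
  have Sae1 : S (a ^+ (q ^ e).-1).
    rewrite qm mulnC expgnA; apply: (is_subgroupX (K := S)) => //.
    by move: Sq; rewrite -{1}(prednK q_gt0) expgSr mulgK.
  have qe_gt0 : (0 < q ^ e)%N by rewrite expn_gt0 q_gt0.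
  case: (q ^ e)%N qe_gt0 Sae Sae1 {qm} => // l _ Sl1 Sl.
  by have := SM _ _ (SV _ Sl) Sl1; rewrite expgSr mulKg.
split=> //; suff SbV : S b^-1 by rewrite -(invgK b); exact: SV.
(* [N u] is the sum of the [act (a ^+ l) u - u] plus [u *+ q], which vanishes since [p] divides
   [q]. *)
have BN u : (u *+ p = 0)%R -> B (N u).
  move=> up; have := relator_values_sum (index_enum 'I_q)
    (fun l : 'I_q => (is_subgroupX l S_subgroup Sa : S (a ^+ l)) u up).
  rewrite big_split /= sumrN sumr_const card_ord -/(N u) /q.
  by rewrite -(prednK n_gt0) expnS mulrnA up mul0rn subr0.
move=> u up; have := relator_valuesB (Ha _ up) (BN _ up).
rewrite addrC addKr -(gactM actP) => /(S_cancel Sq); apply.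
by rewrite mulrnBl up act_torsion // subrr.
Qed.

Lemma relator_values_augmentation g u :
  (u *+ p = 0)%R -> B (act g u - u)%R.
Proof.
suff ST : S = setT by have Sg : S g; [rewrite ST|exact: Sg].
apply: generated => // i; rewrite -(odd_double_half i).
suff [Se So] : S (x i./2.*2) /\ S (x i./2.*2.+1) by case: (odd i).
elim/ltn_ind: i./2 => k IH; case: k IH => [|k] IH; first exact: S_first.
(* The block is preceded by [w], so its Fox coefficients come with the action of [w]. As [w] lies in
   [S] by induction, [S_cancel] removes that action. *)
set w := demushkin_partial p n x k.+1.
have Sw : S w.
  have [S1 SM _] := S_subgroup; apply: (SM).
    by apply: (is_subgroupX (K := S)) => //; have [] := IH 0%N isT.
  elim: {-2}k.+1 (leqnn k.+1) => [|l IHl] lk.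
    by rewrite big_ord0.
  rewrite big_ord_recr /=; apply: (SM); first exact/IHl/ltnW.
  by have [Se So] := IH l lk; apply: (is_subgroupR (K := S)).
apply: block => v vp; apply: (S_cancel Sw).
- by rewrite act_torsion // mulrnBl vp act_torsion // subrr.
- have [D tD Dx] := single k.+1.*2 vp; exists D => //; have [dD _ _] := tD.
  rewrite (@D_block D k.+1) //=; last first.
    by move=> j kj; rewrite Dx; case: eqP kj => // ->; rewrite leq_double ltnn.
  rewrite D_initial //; last first.
    by move=> j kj; rewrite Dx; case: eqP kj => // ->; rewrite ltnn.
  rewrite (derivationR actP dD) !Dx eqxx.
  by rewrite (gtn_eqF (ltnSn _)) !(gact0 actP, subr0, addr0, add0r).
- by rewrite !act_torsion // mulrnBl vp act_torsion // subrr.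
- have [D tD Dx] := single k.+1.*2.+1 vp; exists D => //; have [dD _ _] := tD.
  rewrite (@D_block D k.+1) //=; last first.
    by move=> j kj; rewrite Dx; case: eqP kj => // ->; rewrite doubleS ltnn.
  rewrite D_initial //; last first.
    by move=> j kj; rewrite Dx; case: eqP kj => // ->; rewrite ltnNge leqnSn.
  rewrite (derivationR actP dD) !Dx eqxx.
  by rewrite (ltn_eqF (ltnSn _)) !(gact0 actP, subr0, addr0, add0r).
Qed.

End DemushkinRelator.

(** * Crossed homomorphisms to permutation modules *)

(** A left action, since permutations compose from left to right. On the cosets of a subgroup it
    gives the coinduced module of Shapiro's lemma. *)
Definition perm_act (F : groupType) (T : finType) (A : zmodType)
    (rho : F -> {perm T}) (g : F) (u : {ffun T -> A}) : {ffun T -> A} :=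
  [ffun i => u (rho g i)].

Lemma perm_actP (F : groupType) (T : finType) (A : zmodType)
    (rho : F -> {perm T}) :
  {morph rho : u v / u * v} -> group_action (@perm_act F T A rho).
Proof.
move=> rhoM; split=> [u|g h u|g u v]; apply/ffunP => i; rewrite !ffunE //.
- by rewrite (morphism1 rhoM) perm1.
- by rewrite rhoM permM.
Qed.

Lemma perm_act_trivial (F : topGroupType) (T : finType) (A : zmodType)
    (rho : F -> {perm T}) : nbhs 1 [set g | rho g = 1] ->
  nbhs 1 [set g | forall u : {ffun T -> A}, perm_act rho g u = u].
Proof.
by apply: filterS => g /= g1 u; apply/ffunP => i; rewrite ffunE g1 perm1.
Qed.

(* [wreath s u] is the element [(u, s)] of the wreath product of [A] by the
   permutations of [T], acting on [T * A]. *)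
Section Wreath.
Variables (T : finType) (A : finZmodType).
Implicit Types (s t : {perm T}) (u v : {ffun T -> A}).

Definition wreath_fun s u (z : T * A) : T * A := (s z.1, z.2 + u z.1)%R.

Lemma wreath_fun_inj s u : injective (wreath_fun s u).
Proof. by move=> [i a] [j b] [/perm_inj -> /addIr ->]. Qed.

Definition wreath s u : {perm T * A} := perm (@wreath_fun_inj s u).

Lemma wreathE s u i a : wreath s u (i, a) = (s i, a + u i)%R.
Proof. by rewrite permE. Qed.

Lemma wreathM s u t v :
  wreath s u * wreath t v = wreath (s * t) (u + [ffun i => v (s i)])%R.
Proof. by apply/permP => -[i a]; rewrite permM !wreathE permM !ffunE addrA. Qed.

Lemma wreath10 : wreath 1 0%R = 1.
Proof. by apply/permP => -[i a]; rewrite wreathE !perm1 ffunE addr0. Qed.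

Lemma wreath1X u m : wreath 1 u ^+ m = wreath 1 (u *+ m)%R.
Proof.
elim: m => [|m IH]; first by rewrite mulr0n wreath10.
rewrite expgS IH wreathM mulg1 mulrS; congr (wreath _ (_ + _)%R).
by apply/ffunP => i; rewrite ffunE perm1.
Qed.

Lemma wreath_inj s u t v : wreath s u = wreath t v -> s = t /\ u = v.
Proof.
move=> E; split.
  apply/permP => i; have := congr1 (fun w : {perm T * A} => (w (i, 0%R)).1) E.
  by rewrite /= !wreathE.
apply/ffunP => i; have := congr1 (fun w : {perm T * A} => (w (i, 0%R)).2) E.
by rewrite /= !wreathE !add0r.
Qed.

Definition wreath_set (P : {group {perm T}}) : {set {perm T * A}} :=
  [set w | [exists s in P, exists u, w == wreath s u]]%SET.

Lemma wreath_setP (P : {group {perm T}}) w :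
  reflect (exists s u, s \in P /\ w = wreath s u) (w \in wreath_set P).
Proof.
rewrite inE; apply: (iffP exists_inP) => [[s Ps /existsP[u /eqP ->]]|[s [u [Ps
  ->]]]].
  by exists s, u.
by exists s => //; apply/existsP; exists u.
Qed.

Lemma wreath_group_set (P : {group {perm T}}) : group_set (wreath_set P).
Proof.
apply/group_setP; split.
  by apply/wreath_setP; exists 1, 0%R; rewrite group1 wreath10.
move=> _ _ /wreath_setP[s [u [Ps ->]]] /wreath_setP[t [v [Pt ->]]].
apply/wreath_setP; exists (s * t), (u + [ffun i => v (s i)])%R.
by rewrite groupM // wreathM.
Qed.

Lemma wreath_pgroup (p : nat) (P : {group {perm T}}) : prime p -> p.-group P ->
  (exists e, forall a : A, a *+ p ^ e = 0)%R -> p.-group (wreath_set P).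
Proof.
move=> p_pr pP [e Ae]; pose W := group (wreath_group_set P).
have wX s u m : exists v, wreath s u ^+ m = wreath (s ^+ m) v.
  elim: m => [|m [v IH]]; first by exists 0%R; rewrite wreath10.
  by rewrite !expgS IH wreathM; eexists.
apply: (@pgroup_exponent _ _ W) => // _ /wreath_setP[s [u [Ps ->]]].
have [v Ev] := wX s u #|P|; exists (logn p #|P| + e)%N.
rewrite expnD expgnA -card_pgroup // Ev expg_cardG // wreath1X.
by rewrite (_ : v *+ _ = 0)%R ?wreath10 //; apply/ffunP => i;
  rewrite ffunMnE Ae ffunE.
Qed.

Variables (F : topGroupType) (rho : F -> {perm T}).
Hypotheses (rhoM : {morph rho : u v / u * v}) (rho1 : nbhs 1 [set g | rho g =
  1]).

Lemma wreath_morphism (D : F -> {ffun T -> A}) : derivation (perm_act rho) D ->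
  {morph (fun g => wreath (rho g) (D g)) : u v / u * v}.
Proof. by move=> dD g h; rewrite wreathM rhoM dD. Qed.

Lemma wreath_kernel (D : F -> {ffun T -> A}) : nbhs 1 [set g | D g = 0%R] ->
  nbhs 1 [set g | wreath (rho g) (D g) = 1].
Proof. by apply: filterS2 rho1 => g /= -> ->; exact: wreath10. Qed.

(** A derivation over [rho] amounts to a lift of [rho] to the wreath product. Freeness gives a
    morphism with the right values at the [x i], and the set [S] serves to check that it lies over
    [rho]. *)
Lemma free_pro_p_derivation (p : nat) (x : nat -> F) (f : nat -> {ffun T -> A})
  :
  prime p -> is_free_pro_p p x -> (exists e, forall a : A, a *+ p ^ e = 0)%R ->
  (\forall i \near \oo, f i = 0%R) ->
  exists D : F -> {ffun T -> A}, [/\ derivation (perm_act rho) D,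
    nbhs 1 [set g | D g = 0%R] & forall i, D (x i) = f i].
Proof.
move=> p_pr Fx Ae f0; have [pF x1 _] := Fx.
pose P := group (fimage_group_set rhoM (@is_subgroupT F)).
have pP : p.-group P by exact: (pgroup_fimage p_pr pF rhoM rho1).
pose W := group (wreath_group_set P).
have rx1 : \forall i \near \oo, rho (x i) = 1 := x1 _ rho1.
have [|i||phi [phiM phi1 phix _]] :=
    @free_pro_p_lift p F x p_pr Fx _ W (fun i => wreath (rho (x i)) (f i)).
- exact: wreath_pgroup.
- by apply/wreath_setP; exists (rho (x i)), (f i); rewrite mem_fimage.
- by apply: filterS2 f0 rx1 => i -> ->; exact: wreath10.
pose S g := exists u, phi g = wreath (rho g) u.
have ST : S = setT.
  apply: (free_pro_p_generated p_pr Fx) => [||i].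
  - split=> [|g h [u Su] [v Sv]|g [u Su]].
    + by exists 0%R; rewrite (morphism1 phiM) (morphism1 rhoM) wreath10.
    + by rewrite /S phiM Su Sv wreathM rhoM; eexists.
    + exists (- perm_act rho g^-1 u)%R; rewrite (morphismV phiM) Su.
      apply: (@mulgI _ (wreath (rho g) u)); rewrite mulgV wreathM.
      rewrite (morphismV rhoM) mulgV -wreath10; congr wreath.
      apply/ffunP => i; rewrite !ffunE (morphismV rhoM).
      by rewrite permK subrr.
  - by apply: filterS2 phi1 rho1 => g /= pg rg; exists 0%R;
      rewrite pg rg wreath10.
  - by exists (f i); exact: phix.
have phiE g : S g by rewrite ST.
pose D g := projT1 (cid (phiE g)).
have DE g : phi g = wreath (rho g) (D g) by rewrite /D; case: cid.
exists D; split=> [g h||i].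
- have := phiM g h; rewrite !DE wreathM rhoM => /wreath_inj[_ ->];
    congr (_ + _)%R.
- apply: filterS2 phi1 rho1 => g /=; rewrite DE => + rg.
  by rewrite rg -wreath10 => /wreath_inj[].
- by have := phix i; rewrite DE => /wreath_inj[].
Qed.

End Wreath.

(** * Demushkin groups *)

Section QuotientMap.
Variables (F G : topGroupType) (R : set F) (pi : F -> G).
Hypothesis piR : is_quotient_map R pi.

Lemma quotient_map_continuous : continuous pi.
Proof. by have [_ _ _ pio] := piR; apply/continuousP => U /pio. Qed.

Lemma quotient_map_nbhs1 (U : set G) : is_subgroup U -> nbhs 1 (pi @^-1` U) ->
  nbhs 1 U.
Proof.
have [piM _ _ pio] := piR => sU U1; apply: open_subgroup_nbhs1 => //; apply/pio.
by apply: open_subgroup => //; exact: is_subgroup_preimage.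
Qed.

Lemma quotient_map_open_image (H : set F) : is_subgroup H -> nbhs 1 H ->
  nbhs 1 (pi @` H).
Proof.
have [piM _ _ _] := piR => sH H1; apply: quotient_map_nbhs1.
  exact: is_subgroup_image.
by apply: filterS H1 => h Hh; exists h.
Qed.

Lemma quotient_pro_p (p : nat) : prime p -> is_pro_p p F -> closed R ->
  is_pro_p p G.
Proof.
have [piM pis kerpi pio] := piR => p_pr pF cR; have [[Fc _ Fb] _] := pF.
apply: is_pro_pP => //; first split.
- rewrite (_ : [set: G] = pi @` [set: F]).
    apply: continuous_compact Fc; apply: continuous_subspaceT.
    exact: quotient_map_continuous.
  by apply/seteqP; split=> // g _; have [u <-] := pis g; exists u.
- move=> a b ab; apply: contrapT => neq_ab.
  have [u pu] := pis (a^-1 * b).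
  have nRu : (~` R) u.
    by rewrite -kerpi /= pu => /mulg1_eq; rewrite invgK.
  have /nbhs_mul1 /Fb [H [sH oH HR]] : nbhs u (~` R).
    by apply: open_nbhs_nbhs; split=> //; exact: closed_openC.
  have H1 := quotient_map_open_image sH (open_subgroup_nbhs1 sH oH).
  have [_ KM KV] := is_subgroup_image piM sH.
  have [z [/= az bz]] := ab _ _ (nbhs1_mul a H1) (nbhs1_mul b H1).
  have [h Hh hu] := KM _ _ az (KV _ bz).
  have [_ _ HV] := sH.
  apply: (HR _ (HV _ Hh)); rewrite -kerpi /= piM (morphismV piM) hu pu.
  by rewrite invgM invgK mulgA -(mulgA a^-1) mulVKg mulgV.
- move=> U U1.
  have /Fb [H [sH oH HU]] : nbhs 1 (pi @^-1` U).
    by apply: quotient_map_continuous; rewrite (morphism1 piM).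
  exists (pi @` H); split.
  + exact: is_subgroup_image.
  + apply: open_subgroup; first exact: is_subgroup_image.
    exact/quotient_map_open_image/open_subgroup_nbhs1.
  + by move=> _ [h /HU + <-].
- move=> N g [sN nN] /pio oN; have [u <-] := pis g.
  have [|k Nk] := @pro_p_power p F (pi @^-1` N) u pF _ oN.
    split; first exact: is_subgroup_preimage.
    by move=> v w Nv; rewrite /= conjgE !piM (morphismV piM); exact: nN.
  by exists k; rewrite -(morphismX piM).
Qed.

End QuotientMap.

Lemma kernel_closed_normal (G : topGroupType) (gT : groupType) (f : G -> gT) :
  {morph f : u v / u * v} -> nbhs 1 [set g | f g = 1] ->
  is_closed_normal_subgroup (f @^-1` [set 1]).
Proof.
move=> fM f1; have nK := kernel_normal fM; split=> //.
by apply: closed_open_subgroup (open_kernel fM f1); case: nK.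
Qed.

Section Demushkin.
Variables (p n : nat) (G F : topGroupType) (x : nat -> F) (r : F) (pi : F -> G).
Hypotheses (p_pr : prime p) (n_gt0 : (0 < n)%N) (Fx : is_free_pro_p p x).
Hypothesis xr : demushkin_partial p n x @ \oo --> r.
Hypothesis piR :
  is_quotient_map (smallest (@is_closed_normal_subgroup F) [set r]) pi.

Lemma demushkin_pro_p : is_pro_p p G.
Proof.
have [pF _ _] := Fx; apply: (quotient_pro_p piR) => //.
by rewrite /smallest; apply: closed_bigI => N [[_ cN] _].
Qed.

Lemma demushkin_relator : pi r = 1.
Proof.
have [_ _ kerpi _] := piR; suff : (pi @^-1` [set 1]) r by [].
by rewrite kerpi => N [_]; apply.
Qed.

(** The kernel of [Phi] is closed, normal and contains [r], hence contains the kernel of [pi]. *)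
Lemma demushkin_factor (gT : finGroupType) (Phi : F -> gT) :
  {morph Phi : u v / u * v} -> nbhs 1 [set u | Phi u = 1] -> Phi r = 1 ->
  exists Psi : G -> gT, [/\ {morph Psi : u v / u * v},
    nbhs 1 [set g | Psi g = 1] & forall u, Psi (pi u) = Phi u].
Proof.
move=> PhiM Phi1 Phir; have [piM pis kerpi _] := piR.
have kerE u : pi u = 1 -> Phi u = 1.
  move=> pu; have : (pi @^-1` [set 1]) u by [].
  rewrite kerpi => /(_ (Phi @^-1` [set 1])); apply; split=> [|_ ->] //.
  exact: kernel_closed_normal.
have PhiE u v : pi u = pi v -> Phi u = Phi v.
  move=> uv; rewrite -(mulVKg v u) PhiM (kerE (v^-1 * u)) ?mulg1 //.
  by rewrite piM (morphismV piM) uv mulVg.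
pose Psi g := Phi (projT1 (cid (pis g))).
have PsiE u : Psi (pi u) = Phi u by rewrite /Psi; case: cid => v /= /PhiE.
have PsiM : {morph Psi : u v / u * v}.
  by move=> g h; have [u <-] := pis g; have [v <-] := pis h; rewrite -piM !PsiE.
exists Psi; split=> //.
apply: (quotient_map_nbhs1 piR); first by case: (kernel_normal PsiM).
by apply: filterS Phi1 => u; rewrite /= PsiE.
Qed.

(** As [A] is abelian and killed by p^n, the partial products of the relator map to [0], and so does
    [r]; the values at the generators can therefore be prescribed. *)
Lemma demushkin_character (A : finZmodType) (f : nat -> A) :
  (forall a : A, a *+ p ^ n = 0)%R -> (\forall i \near \oo, f i = 0%R) ->
  exists chi : G -> A, [/\ forall g h, chi (g * h) = (chi g + chi h)%R,
    nbhs 1 [set g | chi g = 0%R] & forall i, chi (pi (x i)) = f i].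
Proof.
move=> An f0.
have [|||chi [chiM chi1 chix _]] := @free_pro_p_lift p F x p_pr Fx A [set: A]%G
  f.
- by apply: pgroup_exponent => // a _; exists n; rewrite FinRing.zmodXgE An.
- by move=> i; rewrite finset.in_setT.
- exact: f0.
have chir : chi r = 1.
  have [N _ /(_ N)] : \forall k \near \oo, chi (demushkin_partial p n x k) = chi
    r.
    exact: xr (nbhs_locally_constant chiM chi1 r).
  rewrite /= leqnn => /(_ isT) <-;
    rewrite chiM (morphismX chiM) FinRing.zmodXgE An FinRing.zmodMgE add0r.
  elim: N => [|N IH]; first by rewrite big_ord0 (morphism1 chiM).
  rewrite big_ord_recr /= chiM IH (morphismR chiM) mul1g.
  by apply/eqP/commgP; rewrite /commute !FinRing.zmodMgE addrC.
have [chiG [chiGM chiG1 chiGE]] := demushkin_factor chiM chi1 chir.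
by exists chiG; split=> // i; rewrite chiGE chix.
Qed.

End Demushkin.

(* [f] is a continuous homomorphism from the subgroup [H] to the discrete group
   [A]; its values outside [H] are junk. *)
Definition hom_on (G : topGroupType) (A : zmodType) (H : set G) (f : G -> A) :=
  (forall g h, H g -> H h -> f (g * h) = (f g + f h)%R) /\
  nbhs 1 [set g | H g -> f g = 0%R].

Section HomOn.
Variables (G : topGroupType) (A : zmodType) (H : set G) (f : G -> A).
Hypotheses (sH : is_subgroup H) (fH : hom_on H f).

Lemma hom_on1 : f 1 = 0%R.
Proof.
by have [H1 _ _] := sH; have [fM _] := fH; apply: (@addrI _ (f 1));
  rewrite -fM // mulg1 addr0.
Qed.

Lemma hom_onM g h : H g -> H h -> f (g * h) = (f g + f h)%R.
Proof. by case: fH => fM _; exact: fM. Qed.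

Lemma hom_onV g : H g -> f g^-1 = (- f g)%R.
Proof.
move=> Hg; have [_ _ HV] := sH; apply/eqP;
  rewrite -addr_eq0 -hom_onM ?mulVg ?hom_on1 //.
exact: HV.
Qed.

Lemma hom_onX g m : H g -> f (g ^+ m) = (f g *+ m)%R.
Proof.
move=> Hg; elim: m => [|m IH]; first by rewrite hom_on1.
by rewrite expgS hom_onM ?IH ?mulrS //; exact: is_subgroupX.
Qed.

Lemma hom_onR g h : H g -> H h -> f [~ g, h] = 0%R.
Proof.
move=> Hg Hh; have [_ HM HV] := sH; have HVg := HV _ Hg; have HVh := HV _ Hh.
rewrite commgEl conjgE !hom_onM ?hom_onV //; do ?[exact: HM].
  by rewrite addrCA addKr addNr.
by apply: (HM) => //; exact: HM.
Qed.

Lemma hom_on_kernel : is_subgroup [set g | H g /\ f g = 0%R].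
Proof.
have [H1 HM HV] := sH; split=> [|g h [Hg fg] [Hh fh]|g [Hg fg]].
- by split=> //; exact: hom_on1.
- by split; [exact: HM|rewrite hom_onM // fg fh addr0].
- by split; [exact: HV|rewrite hom_onV // fg oppr0].
Qed.

Lemma hom_on_kernel_closed : closed H -> closed [set g | H g /\ f g = 0%R].
Proof.
move=> cH g cg; have [_ HM HV] := sH.
have Hg : H g by apply: cH; apply: closureS cg => h [].
split=> //; have [_ f1] := fH;
  have [h [[Hh fh] /= fgh]] := cg _ (nbhs1_mul g f1).
have Hgh : H (g^-1 * h) by apply: HM => //; exact: HV.
by have := hom_onM Hg Hgh; rewrite mulVKg fh fgh // addr0.
Qed.

Lemma hom_on_closure (S : set G) : H = closure (subgroup_gen S) ->
  (forall s, S s -> f s = 0%R) -> forall h, H h -> f h = 0%R.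
Proof.
move=> HS Sf h Hh; suff [] : [set g | H g /\ f g = 0%R] h by [].
have : closed [set g | H g /\ f g = 0%R].
  by apply: hom_on_kernel_closed; rewrite HS; exact: closed_closure.
move/closure_id ->; move: Hh; rewrite {1}HS; apply: closureS.
apply: subgroup_gen_min; first exact: hom_on_kernel.
move=> s Ss; split; last exact: Sf.
by rewrite HS; apply: subset_closure; exact: sub_subgroup_gen.
Qed.

End HomOn.

Lemma open_normal_base (G : topGroupType) (U : set G) :
  is_profinite G -> nbhs 1 U ->
  exists N, [/\ is_normal_subgroup N, open N & N `<=` U].
Proof.
move=> [Gc _ Gb] /Gb [V [sV oV VU]].
have [T [o [rho [rhoM rho1 stab _ _]]]] := coset_action Gc sV oV.
exists (rho @^-1` [set 1]); split; [exact: kernel_normal|exact: open_kernel|].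
by move=> g /= rg; apply: VU; apply/stab; rewrite rg perm1.
Qed.

(** Take [N] open and normal such that [f] vanishes on the intersection of [H] and [N]; then [f]
    extends to [V = H N], trivially on [N]. The last clause carries divisibility of the values from
    [H] over to [V]. *)
Lemma hom_on_extend (G : topGroupType) (A : zmodType) (H : set G) (f : G -> A) :
  is_profinite G -> is_subgroup H -> hom_on H f ->
  exists (V : set G) (f' : G -> A),
    [/\ [/\ is_subgroup V, open V & H `<=` V], hom_on V f',
        forall h, H h -> f' h = f h
      & forall v, V v -> exists2 h, H h & f' v = f h].
Proof.
move=> Gp sH fH; have [H1 HM HV] := sH; have [fM f1] := fH.
have [N [[[N1 NM NV] nN] oN Nf]] := open_normal_base Gp f1.
have Nn : nbhs 1 N by exact: open_subgroup_nbhs1.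
pose V : set G := [set g | exists2 h, H h & N (h^-1 * g)].
pose f' g := if pselect (V g) is left Vg then f (projT1 (cid2 Vg)) else 0%R.
have f'E g h : H h -> N (h^-1 * g) -> f' g = f h.
  move=> Hh Nhg; rewrite /f'; case: pselect => [Vg|[]]; last by exists h.
  case: cid2 => k Hk Nkg /=; apply/eqP; rewrite -subr_eq0 addrC.
  rewrite -(hom_onV sH fH) // -(hom_onM fH) //; last exact: HV.
  apply/eqP/Nf; last by apply: HM => //; exact: HV.
  have := NM _ _ Nhg (NV _ Nkg).
  by rewrite invgM invgK -mulgA mulVKg.
have sV : is_subgroup V.
  split.
  - by exists 1; rewrite ?invg1 ?mulg1.
  - move=> a b [h Hh Nh] [k Hk Nk]; exists (h * k); first exact: HM.
    have := NM _ _ (nN _ k Nh) Nk.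
    by rewrite conjgE invgM -!mulgA mulVKg.
  - move=> a [h Hh Nh]; exists h^-1; first exact: HV.
    have := nN _ h^-1 (NV _ Nh).
    by rewrite conjgE !invgK invgM invgK -!mulgA mulgV mulg1.
exists V, f'; split; [split|split|by move=> h Hh; apply: f'E => //;
  rewrite mulVg|].
- exact: sV.
- apply: open_subgroup => //; apply: filterS Nn => g Ng.
  by exists 1; rewrite ?invg1 ?mul1g.
- by move=> h Hh; exists h => //; rewrite mulVg.
- move=> a b [h Hh Nh] [k Hk Nk].
  rewrite (f'E _ _ Hh Nh) (f'E _ _ Hk Nk) -fM //; apply: f'E; first exact: HM.
  have := NM _ _ (nN _ k Nh) Nk.
  by rewrite conjgE invgM -!mulgA mulVKg.
- apply: filterS Nn => g Ng _; rewrite (f'E _ 1) ?invg1 ?mul1g //.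
  exact: (hom_on1 sH fH).
- by move=> g [h Hh Nh]; exists h => //; exact: f'E.
Qed.

Lemma derivation_unique (p : nat) (F : topGroupType) (x : nat -> F)
    (M : zmodType) (act : F -> M -> M) (C D : F -> M) :
  prime p -> is_free_pro_p p x -> group_action act ->
  derivation act C -> nbhs 1 [set g | C g = 0%R] ->
  derivation act D -> nbhs 1 [set g | D g = 0%R] ->
  (forall i, C (x i) = D (x i)) -> C =1 D.
Proof.
move=> p_pr Fx actP dC C1 dD D1 CD g.
suff S : [set g | C g = D g] = setT by have : [set g | C g = D g] g by rewrite
  S.
apply: (free_pro_p_generated p_pr Fx) => //.
- split=> [|a b /= Ea Eb|a /= Ea].
  + by rewrite /= (derivation1 actP dC) (derivation1 actP dD).
  + by rewrite dC dD Ea Eb.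
  + by rewrite (derivationV actP dC) (derivationV actP dD) Ea.
- by apply: filterS2 C1 D1 => a /= -> ->.
Qed.

Lemma Fp_mulrn (p : nat) (a : 'F_p) m : prime p -> (p %| m)%N -> (a *+ m = 0)%R.
Proof.
by move=> p_pr /dvdnP[k ->]; rewrite mulrnA -mulr_natr pchar_Fp_0 // mulr0.
Qed.

(** [g] permutes the fibre over [i] cyclically, so a constant function on this fibre is the norm of
    a function supported at one point. *)
Lemma perm_act_translation (p : nat) (F : groupType) (T : finType)
    (A : zmodType) (rho : F -> {perm T * 'F_p}) (i : T) (g : F) (a : A)
    (u := [ffun z => if z == (i, 0%R) then a else 0%R] : {ffun T * 'F_p -> A}) :
  prime p -> {morph rho : u v / u * v} ->
  (forall z, (rho g z).1 = i -> z.1 = i) ->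
  (forall s, rho g (i, s) = (i, s + 1)%R) ->
  (\sum_(s : 'F_p) perm_act rho (g ^+ s) u =
   [ffun z => if z.1 == i then a else 0])%R.
Proof.
move=> p_pr rhoM g1 gs; apply/ffunP => -[j t]; rewrite sum_ffunE ffunE /=.
have gX m s : rho (g ^+ m) (i, s) = (i, s + m%:R)%R.
  elim: m s => [|m IH] s; first by rewrite (morphism1 rhoM) perm1 addr0.
  by rewrite expgS rhoM permM gs IH -addrA -mulrS.
have gX1 m z : (rho (g ^+ m) z).1 = i -> z.1 = i.
  elim: m z => [|m IH] z; first by rewrite (morphism1 rhoM) perm1.
  by rewrite expgS rhoM permM => /IH /g1.
case: eqP => [->|ji]; last first.
  rewrite big1 // => s _; rewrite !ffunE; case: eqP => // E.
  by case: ji; have := @gX1 s (j, t); rewrite E; apply.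
rewrite (bigD1 (- t)%R) // big1 => [|s st].
  by rewrite !ffunE gX natr_Zp addrN eqxx /= addr0.
by rewrite !ffunE gX natr_Zp xpair_eqE eqxx andTb addrC addr_eq0 (negPf st).
Qed.

(** * Division by [p] of homomorphisms on finitely generated subgroups *)

Section Demushkin.
Variables (p n : nat) (G F : topGroupType) (x : nat -> F) (r : F) (pi : F -> G).
Hypotheses (p_pr : prime p) (n_gt0 : (0 < n)%N) (Fx : is_free_pro_p p x).
Hypothesis xr : demushkin_partial p n x @ \oo --> r.
Hypothesis piR :
  is_quotient_map (smallest (@is_closed_normal_subgroup F) [set r]) pi.

Let piM : {morph pi : u v / u * v}. Proof. by case: piR. Qed.
Let pG : is_pro_p p G. Proof. exact: demushkin_pro_p Fx piR. Qed.

(* A finitely generated subgroup has fewer than [p ^ N] characters to [F_p] for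
   [N] large, whereas [G] has [p ^ N] characters supported on [x 0, ..., x (N
   - 1)]; so some nontrivial difference of two of them vanishes on [H] and on
   coset representatives of [V]. *)
Lemma demushkin_separating_character (H V : set G) :
  is_closed_subgroup H -> topologically_fg H -> is_subgroup V -> open V ->
  exists chi : G -> 'F_p, [/\ hom_on setT chi, forall h, H h -> chi h = 0%R
    & exists2 v, V v & chi v = 1%R].
Proof.
move=> [sH cH] [S Sfin HS] sV oV; have [[Gc _ _] _] := pG.
have [T [o [rho [rhoM _ stab trans _]]]] := coset_action Gc sV oV.
pose t i := projT1 (cid (trans i)).
have tK i : rho (t i) o = i by rewrite /t; case: cid.
pose Y : finType := (fset_set S + T)%type.
pose y (z : Y) : G := match z with inl s => val s | inr i => t i end.
pose N := #|Y|.+1.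
pose ext (a : {ffun 'I_N -> 'F_p}) i := if insub i is Some j then a j else 0%R.
have /choice[chi chiP] (a : {ffun 'I_N -> 'F_p}) : exists chi : G -> 'F_p,
    [/\ forall g h, chi (g * h) = (chi g + chi h)%R,
    nbhs 1 [set g | chi g = 0%R] & forall i, chi (pi (x i)) = ext a i].
  apply: (demushkin_character p_pr Fx xr piR) => [b|].
    by rewrite Fp_mulrn // dvdn_exp.
  by exists N => // i /= Ni; rewrite /ext insubF // ltnNge Ni.
pose ev a : {ffun Y -> 'F_p} := [ffun z => chi a (y z)].
have /injectivePn[a [b neq_ab ev_ab]] : ~~ injectiveb ev.
  apply/negP => /injectiveP /leq_card; rewrite !card_ffun card_Fp // card_ord.
  by rewrite leq_exp2l ?ltnn // prime_gt1.
have [[aM a1 ax] [bM b1 bx]] := (chiP a, chiP b).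
pose c g := (chi a g - chi b g)%R.
have cT : hom_on setT c.
  split=> [g h _ _|]; first by rewrite /c aM bM opprD addrACA.
  by apply: filterS2 a1 b1 => g /= a0 b0 _; rewrite /c a0 b0 subrr.
have cM g h : c (g * h) = (c g + c h)%R by exact: (hom_onM cT).
have cy z : c (y z) = 0%R.
  by have /ffunP/(_ z) := ev_ab; rewrite !ffunE /c => ->; rewrite subrr.
have cH0 h : H h -> c h = 0%R.
  have cH' : hom_on H c.
    split=> [g k _ _|]; first exact: cM.
    by have [_] := cT; apply: filterS => g /= /(_ I) ->.
  apply: (hom_on_closure sH cH' HS) => s Ss.
  have sS : s \in fset_set S by rewrite in_fset_set // inE.
  exact: (cy (inl [` sS]%fset)).
have [v Vv cv] : exists2 v, V v & c v != 0%R.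
  apply: contrapT => noV.
  have cV v : V v -> c v = 0%R.
    by move=> Vv; apply/eqP/negPn/negP => cv; apply: noV; exists v.
  have c0 g : c g = 0%R.
    have Vg : V (g * (t (rho g o))^-1).
      by apply/stab; rewrite rhoM permM (morphismV rhoM) -[X in _ X = _]tK
        permK.
    rewrite -(mulgVK (t (rho g o)) g) cM // cV // add0r.
    exact: (cy (inr _)).
  case/eqP: neq_ab; apply/ffunP => j; have := c0 (pi (x j)).
  by rewrite /c ax bx /ext valK => /eqP; rewrite subr_eq0 => /eqP.
(* The inverse of [c v] in ['F_p], read as a natural number, normalises the value to [1]. *)
exists c; split=> //; exists (v ^+ (c v)^-1%R); first exact: is_subgroupX.
rewrite (hom_onX (@is_subgroupT G) cT) // -mulr_natr.
by rewrite [X in (_ * X)%R]natr_Zp mulfV.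
Qed.

Variable A : finZmodType.
Hypothesis AX : exists e, forall a : A, (a *+ p ^ e = 0)%R.

(* [psi] extends to an open subgroup [V], hence induces a crossed homomorphism
   [c] of [G] to the functions on [T = G / V], and [c = C *+ p] for a crossed
   homomorphism [C] of [F]. The obstruction [C r] is [p]-torsion. Pulled back
   along [T * 'F_p -> T], i.e. restricted to [V :&: ker chi], it is a sum
   over orbits of elements of order [p], so it lies in the augmentation and
   [C] can be corrected by a torsion derivation. *)
Theorem demushkin_divisible_hom (H : set G) (psi : G -> A) :
  is_closed_subgroup H -> topologically_fg H -> hom_on H psi ->
  (forall h, H h -> exists a, psi h = a *+ p)%R ->
  exists2 phi : G -> A, hom_on H phi & forall h, H h -> (phi h *+ p = psi h)%R.
Proof.
move=> cH fgH psiH psi_div; have [sH _] := cH; have [Gp _] := pG;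
  have [Gc _ _] := Gp.
have [V [psi' [[sV oV HV] psiV psiE psi_val]]] := hom_on_extend Gp sH psiH.
have psiV_div v : V v -> exists a, psi' v = (a *+ p)%R.
  by move=> /psi_val[h Hh ->]; exact: psi_div.
have [chi [chiT chiH [v0 Vv0 chi_v0]]] :=
  demushkin_separating_character cH fgH sV oV.
have [T [o [rho [rhoM rho1 stab trans _]]]] := coset_action Gc sV oV.
pose t i := projT1 (cid (trans i)).
have tK i : rho (t i) o = i by rewrite /t; case: cid.
have tV g i : V (t i * g * (t (rho g i))^-1).
  by apply/stab; rewrite !rhoM !permM tK (morphismV rhoM) -[X in _ X = _]tK
    permK.
(* Shapiro's lemma made explicit: the crossed homomorphism of [G] that corresponds to [psi'] for the
   coset representatives [t i]. *)
pose c g : {ffun T -> A} := [ffun i => psi' (t i * g * (t (rho g i))^-1)].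
have dc : derivation (perm_act rho) c.
  move=> g h; apply/ffunP => i; rewrite !ffunE -(hom_onM psiV) //; congr psi'.
  by rewrite rhoM permM !mulgA mulgVK.
have c1 : nbhs 1 [set g | c g = 0%R].
  suff : \forall g \near (1 : G), forall i, psi' (t i * g * (t i)^-1) = 0%R.
    apply: filterS2 rho1 => g /= rg gi; apply/ffunP => i.
    by rewrite !ffunE rg perm1 gi.
  apply: filter_forall => i; have [_ psi1] := psiV.
  have Vi := nbhs1_conj (t i)^-1 (open_subgroup_nbhs1 sV oV).
  apply: filterS2 (nbhs1_conj (t i)^-1 psi1) Vi => g /=.
  by rewrite conjgE invgK mulgA => psi0 /psi0.
(* [half] chooses a quotient by [p] if there is one; the clause at [0] keeps almost all values at
   the generators equal to [0]. *)
have /choice[half halfP] (a : A) : exists b : A,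
    (a = 0 -> b = 0)%R /\ ((exists b', a = b' *+ p) -> a = b *+ p)%R.
  have [->|/eqP a0] := eqVneq a 0%R; first by exists 0%R; rewrite mul0rn.
  have [[b ab]|nb] := pselect (exists b, a = b *+ p)%R; last by exists 0%R.
  by exists b; split=> // /a0.
have [pF x1 _] := Fx.
have pi1 (U : set G) : nbhs 1 U -> nbhs 1 (pi @^-1` U).
  by move=> U1; apply: (quotient_map_continuous piR); rewrite (morphism1 piM).
pose rhoF := rho \o pi.
have rhoFM : {morph rhoF : u v / u * v} by move=> u v;
  rewrite /rhoF /= piM rhoM.
have [|C [dC C1 Cx]] := @free_pro_p_derivation T A F rhoF rhoFM (pi1 _ rho1) p x
    (fun i => [ffun j => half (c (pi (x i)) j)]) p_pr Fx AX.
- have cx : \forall i \near \oo, c (pi (x i)) = 0%R := x1 _ (pi1 _ c1).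
  apply: filterS cx => i ci; apply/ffunP => j; rewrite [LHS]ffunE ci !ffunE.
  by have [-> //] := halfP 0%R.
have CE g : (C g *+ p = c (pi g))%R.
  apply: (@derivation_unique p F x _ (perm_act rhoF) (fun g => C g *+ p)%R (c \o
    pi)) => //.
  - exact: perm_actP.
  - by move=> u v; rewrite dC mulrnDl -(gactMn (perm_actP A rhoFM)).
  - by apply: filterS C1 => u /= ->; rewrite mul0rn.
  - by move=> u v; rewrite /= piM dc.
  - exact: (pi1 _ c1).
  - move=> i; rewrite Cx; apply/ffunP => j; rewrite ffunMnE !ffunE.
    by have [_ <-//] := halfP (psi' (t j * pi (x i) * (t (rho (pi (x i))
      j))^-1));
      exact: psiV_div.
pose chiT' g : {ffun T -> 'F_p} := [ffun=> chi g].
have chiM g h : chi (g * h) = (chi g + chi h)%R by exact: (hom_onM chiT).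
have dchi : derivation (perm_act rho) chiT'.
  by move=> g h; apply/ffunP => i; rewrite !ffunE chiM.
have chi1 : nbhs 1 [set g | chiT' g = 0%R].
  have [_] := chiT; apply: filterS => g /= /(_ I) chig.
  by apply/ffunP => i; rewrite !ffunE.
(* This is the action on the cosets of the kernel of [chi] in [V]; it is transitive since
   [chi v0 = 1]. *)
pose rho' g : {perm T * 'F_p} := wreath (rho g) (chiT' g).
have rhoM' : {morph rho' : u v / u * v} := wreath_morphism rhoM dchi.
have rho1' : nbhs 1 [set g | rho' g = 1] := wreath_kernel rho1 chi1.
have rhoE' g i s : rho' g (i, s) = (rho g i, s + chi g)%R by rewrite wreathE
  ffunE.
pose rhoF' := rho' \o pi.
have rhoFM' : {morph rhoF' : u v / u * v} by move=> u v;
  rewrite /rhoF' /= piM rhoM'.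
have actP := perm_actP A rhoFM'.
pose C' g : {ffun T * 'F_p -> A} := [ffun z => C g z.1].
have dC' : derivation (perm_act rhoF') C'.
  by move=> u v; apply/ffunP => -[i s];
    rewrite !ffunE dC !ffunE /rhoF' /= rhoE'.
have C1' : nbhs 1 [set g | C' g = 0%R].
  by apply: filterS C1 => g /= Cg; apply/ffunP => z; rewrite !ffunE Cg ffunE.
have act1 := perm_act_trivial A (pi1 _ rho1').
have actX : exists e, forall u, perm_act rhoF' (x 0%N ^+ (p ^ e)) u = u :> {ffun
  _ -> A}.
  have [k xk] := pro_p_power (x 0%N) pF (kernel_normal rhoFM')
    (open_kernel rhoFM' (pi1 _ rho1')).
  by exists k => v; apply/ffunP => z; rewrite ffunE xk perm1.
have ext (f : nat -> {ffun T * 'F_p -> A}) :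
    (\forall i \near \oo, f i = 0%R) -> (forall i, f i *+ p = 0)%R ->
    exists2 D, torsion_derivation p (perm_act rhoF') D & forall i, D (x i) = f
      i.
  move=> f0 fp; have [D [dD D1 Dx]] :=
    free_pro_p_derivation rhoFM' (pi1 _ rho1') p_pr Fx AX f0.
  exists D => //; split=> // h.
  apply: (@derivation_unique p F x _ (perm_act rhoF')
    (fun h => D h *+ p)%R (fun=> 0%R)) => //.
  - by move=> v w; rewrite dD mulrnDl -(gactMn actP).
  - by apply: filterS D1 => v /= ->; rewrite mul0rn.
  - by move=> v w; rewrite (gact0 actP) addr0.
  - exact: nearW.
  - by move=> i; rewrite Dx.
have aug := relator_values_augmentation p_pr n_gt0 actP act1 actX xr
  (free_pro_p_generated p_pr Fx) ext.
have Cr i : (C r i *+ p = 0)%R.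
  have /ffunP/(_ i) := CE r; rewrite ffunMnE => ->.
  by rewrite (demushkin_relator piR) (derivation1 (perm_actP A rhoM) dc) ffunE.
have relC' : relator_values p r (perm_act rhoF') (C' r).
  have -> : C' r = (\sum_(i : T) [ffun z => if z.1 == i then C r i else 0])%R.
    apply/ffunP => z; rewrite sum_ffunE ffunE (bigD1 z.1) //= big1.
      by rewrite ffunE eqxx addr0.
    by move=> i iz; rewrite ffunE eq_sym (negPf iz).
  apply: relator_values_sum => // i.
  (* This conjugate of [v0] fixes the coset [i] and translates the fibre above it by [1]. *)
  have [_ pis _ _] := piR; have [g pg] := pis (v0 ^ t i).
  pose u : {ffun T * 'F_p -> A} := [ffun z => if z == (i, 0%R) then C r i else
    0%R].
  have up : (u *+ p = 0)%R.
    by apply/ffunP => z; rewrite ffunMnE !ffunE; case: eqP; rewrite ?Cr ?mul0rn.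
  have gi : rho (pi g) i = i.
    have ti : (rho (t i))^-1 i = o.
      by apply: (@perm_inj _ (rho (t i))); rewrite permKV tK.
    rewrite pg conjgE !rhoM !permM (morphismV rhoM) ti.
    by have /stab -> := Vv0; rewrite tK.
  have chig : chi (pi g) = 1%R.
    by rewrite pg conjgE !chiM (hom_onV (@is_subgroupT G) chiT) // addrC addrK.
  rewrite -(@perm_act_translation p F T A rhoF' i g) // => [|[j s]|s].
  (* Subtracting [u *+ p], which is [0], from the norm of [u] leaves a sum of terms of the
     augmentation. *)
  - rewrite -[X in relator_values _ _ _ X]subr0 -[X in (_ - X)%R]up.
    have -> : (u *+ p = \sum_(s : 'F_p) u)%R by rewrite sumr_const card_Fp.
    by rewrite -sumrB; apply: relator_values_sum => // s; exact: aug.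
  - by rewrite /rhoF' /= rhoE' /= -{1}gi => /perm_inj.
  - by rewrite /rhoF' /= rhoE' gi chig.
have [D [dD D1 Dp] Dr] := relC'.
pose E g := (C' g - D g)%R.
have dE : derivation (perm_act rhoF') E.
  by move=> g h; rewrite /E dC' dD (gactB actP) opprD addrACA.
have E1 : nbhs 1 [set g | E g = 0%R].
  by apply: filterS2 C1' D1 => g; rewrite /E /= => -> ->; rewrite subrr.
pose Phi g := wreath (rhoF' g) (E g).
have PhiM : {morph Phi : u v / u * v} := wreath_morphism rhoFM' dE.
have Phi1 : nbhs 1 [set g | Phi g = 1] := wreath_kernel (pi1 _ rho1') E1.
have Phir : Phi r = 1.
  rewrite /Phi /E Dr subrr /rhoF' /= (demushkin_relator piR) (morphism1 rhoM').
  exact: wreath10.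
have [Psi [PsiM Psi1 PsiE]] := demushkin_factor piR PhiM Phi1 Phir.
(* [H] fixes [z], as it lies in [V] and in the kernel of [chi]; so evaluation at [z] makes the
   derivation additive on [H]. *)
have [_ pis _ _] := piR; pose z : T * 'F_p := (o, 0%R).
have fixz h : H h -> rho' h z = z.
  by move=> Hh; rewrite rhoE' chiH // addr0; have /HV/stab -> := Hh.
have Psiz u : (Psi (pi u) (z, 0%R)).2 = E u z.
  by rewrite PsiE wreathE add0r.
exists (fun h => (Psi h (z, 0%R)).2).
  split=> [g h|].
    have [u <-] := pis g; have [v <-] := pis h => Hu Hv.
    by rewrite -piM !Psiz dE !ffunE fixz.
  by apply: filterS Psi1 => g /= -> _; rewrite perm1.
move=> h Hh; have [u pu] := pis h.
have Vh := HV _ Hh; have Vto : V (t o) by apply/stab; exact: tK.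
have [_ _ VV] := sV; have VtoV := VV _ Vto.
(* At the base coset, [c] is [psi'] of a conjugate of [h] by [t o], an element of [V]; this is
   [psi h] because [A] is abelian. *)
have Cu : (C u o *+ p = psi h)%R.
  have /ffunP/(_ o) := CE u; rewrite ffunMnE => ->.
  have /stab rh := Vh; rewrite ffunE pu rh -mulgA !(hom_onM psiV) //.
    by rewrite (hom_onV sV psiV) // (psiE h) // addrC subrK.
  by case: sV => _ + _; apply.
have Du : (D u z *+ p = 0)%R.
  by have /ffunP/(_ z) := Dp u; rewrite ffunMnE ffunE.
by rewrite -[in LHS]pu Psiz !ffunE mulrnBl Du subr0 -Cu.
Qed.

End Demushkin.

(** * Frattini subgroups *)

Section Frattini.
Variables (p : nat) (G : topGroupType).
Implicit Types H K : set G.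

Lemma frattini_min H K : is_closed_subgroup K ->
  (forall h, H h -> K (h ^+ p)) -> (forall g h, H g -> H h -> K [~ g, h]) ->
  frattini p H `<=` K.
Proof.
move=> [sK cK] HX HR; have -> : K = closure K by exact/closure_id.
apply: closureS.
have [_ KM _] := sK; move=> _ [a aH [b bH <-]]; apply: KM.
  by apply: (subgroup_gen_min sK) aH => _ [h Hh <-]; exact: HX.
by apply: (subgroup_gen_min sK) bH => _ [g Hg [h Hh <-]]; exact: HR.
Qed.

Lemma frattini_subset K : is_closed_subgroup K -> frattini p K `<=` K.
Proof.
move=> cK; have [sK _] := cK; apply: frattini_min => // [h Kh|g h Kg Kh].
  exact: is_subgroupX.
exact: is_subgroupR.
Qed.

Lemma frattiniS H K : H `<=` K -> frattini p H `<=` frattini p K.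
Proof.
move=> HK; apply: closureS => _ [a aH [b bH <-]]; exists a.
  apply: (subgroup_gen_min (subgroup_gen_subgroup _)) aH => _ [h Hh <-].
  by apply: sub_subgroup_gen; exists h => //; exact: HK.
exists b => //.
apply: (subgroup_gen_min (subgroup_gen_subgroup _)) bH => _ [g Hg [h Hh <-]].
apply: sub_subgroup_gen; exists g; first exact: HK.
by exists h => //; exact: HK.
Qed.

Lemma frattiniX K x : K x -> frattini p K (x ^+ p).
Proof.
move=> Kx; apply: subset_closure; exists (x ^+ p).
  by apply: sub_subgroup_gen; exists x.
exists 1; last exact: mulg1.
by have [] := subgroup_gen_subgroup [set [~ x, y] | x in K & y in K].
Qed.

Lemma hom_on_frattini (A : zmodType) K (f : G -> A) : is_closed_subgroup K ->
  hom_on K f -> (forall k, K k -> f k *+ p = 0)%R ->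
  forall y, frattini p K y -> f y = 0%R.
Proof.
move=> [sK cK] fK fp y Fy; suff [] : [set g | K g /\ f g = 0%R] y by [].
apply: frattini_min Fy; first split.
- exact: hom_on_kernel.
- exact: hom_on_kernel_closed.
- by move=> h Kh; split; [exact: is_subgroupX|rewrite (hom_onX sK fK) // fp].
- by move=> g h Kg Kh; split; [exact: is_subgroupR|exact: (hom_onR sK fK)].
Qed.

Lemma frattini_resistantP :
  (forall K x, is_closed_subgroup K -> topologically_fg K ->
     frattini p K (x ^+ p) -> K x) -> frattini_resistant p G.
Proof.
move=> root H K cH cK fH fK; split=> [HK h Hh|]; last exact: frattiniS.
by apply: root => //; apply: HK; exact: frattiniX.
Qed.

End Frattini.

(** The product set is a subgroup because [K] normalises its derived subgroup; its closure is then
    one too. *)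
Lemma frattini_subgroup (p : nat) (G : topGroupType) (K : set G) :
  is_subgroup K -> is_subgroup (frattini p K).
Proof.
move=> sK; apply: closure_subgroup; have [K1 KM KV] := sK.
have sP : is_subgroup (power_subgroup p K) by exact: subgroup_gen_subgroup.
have sD : is_subgroup (derived_subgroup K) by exact: subgroup_gen_subgroup.
have [[P1 PM PV] [D1 DM DV]] := (sP, sD).
have PK a : power_subgroup p K a -> K a.
  apply: (subgroup_gen_min sK) => _ [k Kk <-]; exact: is_subgroupX.
have Dn k d : K k -> derived_subgroup K d -> derived_subgroup K (d ^ k).
  move=> Kk; pose Z := (fun d => d ^ k) @^-1` derived_subgroup K.
  have /subgroup_gen_min sZ : is_subgroup Z.
    by apply: is_subgroup_preimage => // a b; exact: conjMg.
  have KJ a : K a -> K (a ^ k).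
    by move=> Ka; rewrite conjgE; apply: (KM); [exact: KV|exact: KM].
  apply: sZ => _ [a Ka [b Kb <-]]; rewrite /Z /= conjRg.
  by apply: sub_subgroup_gen; exists (a ^ k); [|exists (b ^ k)] => //;
    exact: KJ.
split=> [|_ _ [a Pa [b Db <-]] [c Pc [d Dd <-]]|_ [a Pa [b Db <-]]].
- by exists 1 => //; exists 1; rewrite ?mulg1.
- exists (a * c); first exact: PM.
  exists (b ^ c * d); first by apply: DM => //; apply: Dn => //; exact: PK.
  by rewrite conjgE !mulgA mulgK.
- exists a^-1; first exact: PV.
  exists (b^-1 ^ a^-1); first by apply: Dn; [apply/KV/PK|exact: DV].
  by rewrite conjgE invgK !invgM !mulgA mulVg mul1g.
Qed.

Lemma frattini_image (p : nat) (H H' : topGroupType) (f : H -> H') (K : set H) :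
  {morph f : u v / u * v} -> continuous f ->
  f @` frattini p K `<=` frattini p (f @` K).
Proof.
move=> fM fc z /(closure_image fc); apply: closureS.
move=> _ [_ [a aK [b bK <-]] <-]; rewrite fM; exists (f a).
  pose Z := f @^-1` power_subgroup p (f @` K).
  have /subgroup_gen_min sZ : is_subgroup Z.
    by apply: is_subgroup_preimage => //; exact: subgroup_gen_subgroup.
  apply: (sZ _ _ _ aK) => _ [h Kh <-]; rewrite /Z /= (morphismX fM).
  by apply: sub_subgroup_gen; exists (f h) => //; exists h.
exists (f b) => //; pose Z := f @^-1` derived_subgroup (f @` K).
have /subgroup_gen_min sZ : is_subgroup Z.
  by apply: is_subgroup_preimage => //; exact: subgroup_gen_subgroup.
apply: (sZ _ _ _ bK) => _ [g Kg [h Kh <-]]; rewrite /Z /= (morphismR fM).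
apply: sub_subgroup_gen; exists (f g); first by exists g.
by exists (f h) => //; exists h.
Qed.

Lemma subset_hom_on (G : topGroupType) (A : zmodType) (H K : set G) (f : G -> A)
  :
  H `<=` K -> hom_on K f -> hom_on H f.
Proof.
move=> HK [fM f1]; split=> [g h /HK Kg /HK|]; first exact: fM.
by apply: filterS f1 => g /= fg /HK.
Qed.

Lemma Zp_natr_eq0 N m : (1 < N)%N -> ((m%:R : 'Z_N) == 0)%R = (N %| m)%N.
Proof.
by move=> N_gt1; rewrite -val_eqE /= val_Zp_nat // -/(dvdn _ _) /dvdn.
Qed.

Lemma Zp_exponent (p k : nat) : prime p -> (0 < k)%N ->
  exists e, forall a : 'Z_(p ^ k), (a *+ p ^ e = 0)%R.
Proof.
move=> p_pr k_gt0; exists k => a; rewrite -mulr_natr pchar_Zp ?mulr0 //.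
by rewrite -(exp1n k) ltn_exp2r // prime_gt1.
Qed.

(* A maximal subgroup of a finite [p]-group is normal of index [p], so it is the
   kernel of a character onto [p Z / p^2]. *)
Lemma separating_hom (p : nat) (G : topGroupType) (K : set G) (x : G) :
  prime p -> is_pro_p p G -> is_closed_subgroup K -> ~ K x ->
  exists (V : set G) (psi : G -> 'Z_(p ^ 2)),
    [/\ [/\ is_closed_subgroup V, K `<=` V & V x], hom_on V psi,
        forall v, exists a, psi v = (a *+ p)%R,
        forall k, K k -> psi k = 0%R & psi x != 0%R].
Proof.
move=> p_pr pG [sK cK] nKx; have [Gp _] := pG.
have [T [rho [rhoM rho1 rx]]] := separate_closed_subgroup Gp cK nKx.
pose Kb := group (fimage_group_set rhoM sK).
pose P := group (fimage_group_set rhoM (@is_subgroupT G)).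
pose L := (Kb <*> <[rho x]>)%G.
have KP : Kb \subset P by apply/fintype.subsetP => _ /fimageP[k _ <-];
  exact: mem_fimage.
have xP : rho x \in P by exact: mem_fimage.
have LP : L \subset P by rewrite join_subG KP cycle_subG.
have pL : p.-group L by exact: (pgroup_fimage p_pr pG rhoM rho1 LP).
have xL : rho x \in L by rewrite (fintype.subsetP (joing_subr _ _)) // cycle_id.
have [KL|[M maxM KM]] := maximal_exists (joing_subl Kb <[rho x]>).
  by case/negP: rx; have : rho x \in Kb by rewrite KL.
have nM := p_maximal_normal pL maxM; have iM := p_maximal_index pL maxM.
have [sML nML] := andP nM.
have xM : rho x \notin M.
  apply/negP => xM; have /maxgroupp/properP[_ [y yL /negP[]]] := maxM.
  by apply: (fintype.subsetP _ _ yL); rewrite join_subG KM cycle_subG.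
have xN := fintype.subsetP nML _ xL.
have cLM : #|L / M|%g = p by rewrite card_quotient.
have xLM : coset M (rho x) \in (L / M)%g by exact: mem_quotient.
have ox : #[coset M (rho x)] = p.
  have := order_dvdG xLM; rewrite cLM; have /primeP[_ pP] := p_pr.
  move=> /pP/orP[|/eqP//]; rewrite order_eq1 => /eqP /(coset_idr xN).
  by move/negP: xM.
have LME : (L / M)%g = <[coset M (rho x)]>.
  by apply/eqP; rewrite eq_sym eqEcard cycle_subG xLM cLM -ox /=.
pose V := rho @^-1` [set w | w \in L].
have sV : is_subgroup V.
  apply: is_subgroup_preimage => //; split=> [|y z|y] /=; first exact: group1.
    exact: groupM.
  by rewrite groupV.
have V1 : nbhs 1 V by apply: filterS rho1 => g; rewrite /V /= => ->;
  exact: group1.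
(* A logarithm to the base [rho x] in the quotient of order [p]. Only its class mod [p] matters, so
   its product with [p] is well defined mod p^2. *)
pose e g : nat := if pselect (exists m, coset M (rho g) = coset M (rho x) ^+ m)
  is left E then projT1 (cid E) else 0%N.
have eP g : V g -> coset M (rho g) = coset M (rho x) ^+ e g.
  move=> Vg; rewrite /e; case: pselect => [E|[]]; first by case: cid.
  by apply/cycleP; rewrite -LME; exact: mem_quotient.
have p2 : (1 < p ^ 2)%N by rewrite (ltn_exp2l 0) // prime_gt1.
have e0 g m : V g -> coset M (rho g) = coset M (rho x) ^+ m ->
    ((e g * p)%:R = (m * p)%:R :> 'Z_(p ^ 2))%R.
  move=> /eP -> /eqP; rewrite eq_expg_mod_order ox => em; apply: val_inj => /=.
  by rewrite !val_Zp_nat // expnSr expn1 -!muln_modl (eqP em).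
pose psi g : 'Z_(p ^ 2) := (e g * p)%:R%R.
exists V, psi; split; [split|split| | |].
- by split=> // g; exact: subgroup_limit.
- move=> k Kk; apply: (fintype.subsetP (joing_subl _ _)); exact: mem_fimage.
- exact: xL.
- move=> g h Vg Vh; rewrite /psi -natrD -mulnDl; apply: e0.
    by case: sV => _ + _; apply.
  by rewrite rhoM expgnDr -!eP // morphM // (fintype.subsetP nML).
- apply: filterS rho1 => g /= rg Vg; rewrite /psi (e0 g 0%N) ?mul0n //.
  by rewrite rg morph1.
- by move=> v; exists (e v)%:R%R; rewrite /psi natrM mulr_natr.
- move=> k Kk; rewrite /psi (e0 k 0%N) ?mul0n //.
    by apply: (fintype.subsetP (joing_subl _ _)); exact: mem_fimage.
  by rewrite expg0 coset_id // (fintype.subsetP KM) // mem_fimage.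
- rewrite /psi (e0 x 1%N) // mul1n Zp_natr_eq0 //.
  by rewrite -[X in (_ %| X)%N]expn1 dvdn_Pexp2l // prime_gt1.
Qed.

(** * Extraction of [p]-th roots in the Demushkin group *)

Section Demushkin.
Variables (p n : nat) (G F : topGroupType) (x : nat -> F) (r : F) (pi : F -> G).
Hypotheses (p_pr : prime p) (n_gt0 : (0 < n)%N) (Fx : is_free_pro_p p x).
Hypothesis xr : demushkin_partial p n x @ \oo --> r.
Hypothesis piR :
  is_quotient_map (smallest (@is_closed_normal_subgroup F) [set r]) pi.

(** Otherwise some [psi] with values in p Z/p^2 kills [K] but not [y]. Divide it by [p] on the
    closed subgroup [L] generated by [K] and [y]: the quotient [phi] is [p]-torsion on [K], so it
    kills [frattini p K], whereas [phi (y ^+ p)] is [psi y]. *)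
Lemma demushkin_root (K : set G) (y : G) :
  is_closed_subgroup K -> topologically_fg K -> frattini p K (y ^+ p) -> K y.
Proof.
move=> cK [S Sfin KS] Ky; apply: contrapT => nKy.
have pG := demushkin_pro_p p_pr Fx piR.
have [V [psi [[[sV cV] KV Vy] psiV psi_div psiK psiy]]] :=
  separating_hom p_pr pG cK nKy.
pose L := closure (subgroup_gen (S `|` [set y])).
have cL : is_closed_subgroup L.
  split; last exact: closed_closure.
  exact/closure_subgroup/subgroup_gen_subgroup.
have fL : topologically_fg L.
  by exists (S `|` [set y]) => //; rewrite finite_setU; split.
have SL z : (S `|` [set y]) z -> L z.
  by move=> Sz; apply: subset_closure; exact: sub_subgroup_gen.
have KL : K `<=` L.
  rewrite KS; apply: closureS; apply: subgroup_gen_min.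
    exact: subgroup_gen_subgroup.
  by move=> s Ss; apply: sub_subgroup_gen; left.
have LV : L `<=` V.
  have -> : V = closure V by exact/closure_id.
  apply: closureS; apply: subgroup_gen_min => // z [Sz|->] //.
  by apply: KV; rewrite KS; apply: subset_closure; exact: sub_subgroup_gen.
have [phi phiL phiE] := demushkin_divisible_hom p_pr n_gt0 Fx xr piR
  (Zp_exponent p_pr (isT : 0 < 2)%N) cL fL (subset_hom_on LV psiV) (fun h _ =>
    psi_div h).
have Ly : L y by apply: SL; right.
have phiK k : K k -> (phi k *+ p = 0)%R by move=> Kk; rewrite phiE ?psiK //;
  exact: KL.
case/eqP: psiy; have [sL _] := cL.
rewrite -phiE // -(hom_onX sL phiL) //.
exact: (hom_on_frattini cK (subset_hom_on KL phiL) phiK).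
Qed.

End Demushkin.

(** * The product with the p-adic integers *)

Lemma Zp_intr_mod N (m : int) : (1 < N)%N -> ((m %% N)%Z%:~R = m%:~R :> 'Z_N)%R.
Proof.
move=> N_gt1; rewrite [in RHS](divz_eq m N) [RHS]intrD intrM.
by rewrite -[X in (_ * X)%R]pmulrn pchar_Zp // mulr0 add0r.
Qed.

Section Padic.
Variable p : nat.
Hypothesis p_pr : prime p.
Implicit Types (s t : padic_int p) (k l m : nat).

Let p_gt0 : (0 < p)%N. Proof. exact: prime_gt0. Qed.

Lemma padic_mulE s t k : (s * t) k = ((s k + t k)%R %% (p ^ k)%N)%Z.
Proof. by []. Qed.

Lemma padic_invE s k : (s^-1) k = ((- s k)%R %% (p ^ k)%N)%Z.
Proof. by []. Qed.

Lemma padic_expE s m k : (s ^+ m) k = ((s k *+ m)%R %% (p ^ k)%N)%Z.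
Proof.
elim: m => [|m IH]; first by rewrite mulr0n mod0z.
by rewrite expgS padic_mulE IH modzDmr mulrS.
Qed.

Lemma padic_mulC s t : s * t = t * s.
Proof. by apply: padic_intP => k; rewrite !padic_mulE addrC. Qed.

Lemma padic_res_le s k m : (k <= m)%N -> s k = (s m %% (p ^ k)%N)%Z.
Proof.
move=> /subnK <-; elim: (m - k)%N => [|l IH]; first by rewrite padic_res_mod.
rewrite IH (padic_resP s (l + k)) addSn;
  have := divz_eq (s (l + k).+1) (p ^ (l + k))%N.
rewrite {2}expnD PoszM mulrA => sE; rewrite [in RHS]sE.
by rewrite modzMDl.
Qed.

Lemma padic_res_natP s k : exists2 a : nat, s k = a & (a < p ^ k)%N.
Proof.
have pk : Posz (p ^ k) != 0%R by rewrite eqz_nat -lt0n expn_gt0 p_gt0.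
have := padic_res_mod s k; have := modz_ge0 (s k) pk.
have := ltz_mod (s k) pk; case: (s k %% _)%Z => // a /= a_lt _ <-.
by exists a => //; rewrite ltz_nat in a_lt.
Qed.

Lemma padic_nbhs1 k : nbhs (1 : padic_int p) [set s | s k = 0%R].
Proof. by exists k => s; rewrite /padic_ball /=. Qed.

Lemma padic_nbhs s k : nbhs s [set t | t k = s k].
Proof. by exists k. Qed.

(** An ultrafilter selects one residue at each level; these are compatible and define its limit. *)
Lemma padic_compact : compact [set: padic_int p].
Proof.
rewrite compact_ultra => U FU _.
have PU : ProperFilter U by exact: ultra_proper.
have /choice[a aP] k : exists a : nat, U [set s : padic_int p | s k = a].
  suff [i Ui] : exists i : 'I_(p ^ k), U [set s : padic_int p | s k = i].
    by exists i.
  apply: contrapT => nU.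
  suff : U set0 by exact: filter_not_empty.
  have : U [set s : padic_int p | forall i : 'I_(p ^ k), s k <> Posz i].
    apply: filter_forall => i.
    have [Ui|//] := in_ultra_setVsetC [set s : padic_int p | s k = i] FU.
    by case: nU; exists i.
  apply: filterS => s si; have [b sb b_lt] := padic_res_natP s k.
  exact: (si (Ordinal b_lt)).
have aS k : Posz (a k) = (Posz (a k.+1) %% (p ^ k)%N)%Z.
  have [s [/= <- <-]] := filter_ex (filterI (aP k) (aP k.+1)).
  exact: padic_resP.
exists (PadicInt aS); split=> // A [k kA].
by apply: filterS (aP k) => s sk; apply: kA.
Qed.

Lemma padic_hausdorff : hausdorff_space (padic_int p).
Proof.
move=> s t st; apply: padic_intP => k.
by have [u [/= <- <-]] := st _ _ (padic_nbhs s k) (padic_nbhs t k).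
Qed.

(** Stated for all large [l], so that one exponent serves both factors in [product_pro_p]. *)
Lemma padic_open_power (N : set (padic_int p)) s : nbhs 1 N ->
  exists k, forall l, (k <= l)%N -> N (s ^+ (p ^ l)).
Proof.
move=> [k kN]; exists k => l kl; apply: kN.
rewrite /padic_ball /= padic_expE -mulr_natr natz; apply/dvdz_mod0P.
by rewrite dvdz_mull // dvdzE /= dvdn_exp2l.
Qed.

Definition padic_red k s : 'Z_(p ^ k) := ((s k)%:~R)%R.

Lemma padic_redM k s t : (0 < k)%N ->
  padic_red k (s * t) = (padic_red k s + padic_red k t)%R.
Proof.
move=> k_gt0; rewrite /padic_red padic_mulE Zp_intr_mod ?intrD //.
by rewrite -(exp1n k) ltn_exp2r // prime_gt1.
Qed.

Lemma padic_red_eq0 k s : (padic_red k.+1 s *+ p == 0)%R = (s k == 0%R).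
Proof.
have [a sa a_lt] := padic_res_natP s k.+1.
rewrite (padic_resP s) /padic_red sa -pmulrn -mulr_natr -natrM Zp_natr_eq0;
  last first.
  by rewrite -(exp1n k.+1) ltn_exp2r // prime_gt1.
by rewrite expnSr dvdn_pmul2r // modz_nat eqz_nat -/(dvdn _ _).
Qed.

(** The valuation of [t] is at most [k] and that of [s] at least [k]. The inverse of [t] appears
    because [Bezoutl] produces minus the gcd. *)
Lemma padic_divides s t k m : s k = 0%R -> t k.+1 != 0%R -> (k < m)%N ->
  exists l, (t^-1 ^+ l) m = s m.
Proof.
move=> sk tk km; have [a sa a_lt] := padic_res_natP s m.
have [b tb b_lt] := padic_res_natP t m.
have pka : (p ^ k %| a)%N.
  by move: sk; rewrite (padic_res_le s (ltnW km)) sa modz_nat => -[/eqP].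
have pkb : ~~ (p ^ k.+1 %| b)%N.
  by apply: contraNN tk; rewrite (padic_res_le t km) tb modz_nat eqz_nat.
have /(dvdn_pfactor _ _ p_pr)[v vm gv] := dvdn_gcdl (p ^ m) b.
have vk : (v <= k)%N.
  rewrite leqNgt; apply: contra pkb => kv.
  by rewrite (dvdn_trans _ (dvdn_gcdr (p ^ m) b)) // gv dvdn_exp2l.
have /dvdnP[c ac] : (gcdn (p ^ m) b %| a)%N.
  by rewrite gv (dvdn_trans _ pka) // dvdn_exp2l.
have pm_gt0 : (0 < p ^ m)%N by rewrite expn_gt0 p_gt0.
have [u _ uP] := Bezoutl b pm_gt0; exists (c * u)%N.
apply/eqP; rewrite padic_expE padic_invE -mulr_natr natz modzMml tb sa.
rewrite -[X in _ == X](modz_small (d := Posz (p ^ m))) //.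
rewrite eqz_mod_dvd mulNr -opprD dvdzE abszN -PoszM -PoszD !absz_nat.
by rewrite ac mulnCA -mulnDr addnC (mulnC b) dvdn_mull.
Qed.

Lemma padic_red_nbhs k : nbhs (1 : padic_int p) [set s | padic_red k s = 0%R].
Proof. by apply: filterS (padic_nbhs1 k) => s /= sk; rewrite /padic_red sk. Qed.

Lemma padic_red_hom k : (0 < k)%N -> hom_on [set: padic_int p] (padic_red k).
Proof.
move=> k_gt0; split=> [s t _ _|]; first exact: padic_redM.
by apply: filterS (padic_red_nbhs k) => s /= ->.
Qed.

Lemma padic_closed k : closed [set s : padic_int p | s k != 0%R].
Proof.
move=> s cs; have [t [/= tk st]] := cs _ (padic_nbhs s k).
by rewrite /= -st.
Qed.

Variable G : topGroupType.
Hypothesis pG : is_pro_p p G.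
Local Notation GZ := (G * padic_int p)%type.

Lemma pair_expE (z : GZ) m : z ^+ m = (z.1 ^+ m, z.2 ^+ m).
Proof. by elim: m => [//|m IH]; rewrite !expgS IH. Qed.

Lemma product_compact : compact [set: GZ].
Proof.
have [[Gc _ _] _] := pG; rewrite -setXTT.
exact: compact_setX Gc padic_compact.
Qed.

Lemma product_pro_p : is_pro_p p GZ.
Proof.
have [[Gc Gh Gb] _] := pG; apply: is_pro_pP => //; first split.
- exact: product_compact.
- move=> [a s] [b t] ab; congr pair.
    apply: Gh => A B Aa Bb.
    have [||[u w] [/= Au Bu]] := ab (A `*` setT) (B `*` setT).
    + by exists (A, setT) => //; split=> //; exact: filterT.
    + by exists (B, setT) => //; split=> //; exact: filterT.
    + by exists u; split; [case: Au|case: Bu].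
  apply: padic_hausdorff => A B As Bt.
  have [||[u w] [/= Au Bu]] := ab (setT `*` A) (setT `*` B).
  + by exists (setT, A) => //; split=> //; exact: filterT.
  + by exists (setT, B) => //; split=> //; exact: filterT.
  + by exists w; split; [case: Au|case: Bu].
- move=> U [[A B] /= [A1 [k kB]] ABU].
  have [N [[N1 NM NV] oN NA]] := Gb _ A1.
  pose W := [set z : GZ | N z.1 /\ z.2 k = 0%R].
  exists W; split.
  + split=> [|[a s] [b t] [/= Na sk] [/= Nb tk]|[a s] [/= Na sk]].
    * by split.
    * by split; [exact: NM|rewrite -[LHS]/((s * t) k) padic_mulE sk tk addr0
        mod0z].
    * by split; [exact: NV|rewrite -[LHS]/(s^-1 k) padic_invE sk oppr0 mod0z].
  + rewrite openE => -[a s] [/= Na sk];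
      exists (N, [set t : padic_int p | t k = s k]).
      by split; [exact: open_nbhs_nbhs|exact: padic_nbhs].
    by move=> [b t] [/= Nb tk]; split=> //=; rewrite tk.
  + by move=> [a s] [/= Na sk]; apply: ABU; split; [exact: NA|exact: kB].
- move=> N [a s] [sN nN] oN.
  have [[A B] /= [A1 B1] ABN] : nbhs (1 : GZ) N by exact: open_subgroup_nbhs1.
  have [M [nM oM MA]] := open_normal_base (proj1 pG) A1.
  have [k Mk] := pro_p_power a pG nM oM; have [l Bl] := padic_open_power s B1.
  exists (k + l)%N; apply: ABN; rewrite pair_expE; split => /=.
    by apply: MA; rewrite expnD expgnA; apply: is_subgroupX => //; case: nM.
  by apply: Bl; rewrite leq_addl.
Qed.

End Padic.

(** * Extraction of [p]-th roots in the product *)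

Section Roots.
Variables (p n : nat) (G F : topGroupType) (x : nat -> F) (r : F) (pi : F -> G).
Hypotheses (p_pr : prime p) (n_gt0 : (0 < n)%N) (Fx : is_free_pro_p p x).
Hypothesis xr : demushkin_partial p n x @ \oo --> r.
Hypothesis piR :
  is_quotient_map (smallest (@is_closed_normal_subgroup F) [set r]) pi.
Local Notation GZ := (G * padic_int p)%type.

Lemma fst_closed (K : set GZ) : closed K -> closed (fst @` K).
Proof.
have pG := demushkin_pro_p p_pr Fx piR; have [[_ Gh _] _] := pG.
move=> cK; apply: compact_closed => //; apply: continuous_compact.
  by apply: continuous_subspaceT => z; exact: cvg_fst.
exact: (subclosed_compact cK (product_compact p_pr pG)).
Qed.

Lemma fstM : {morph (fst : GZ -> G) : u v / u * v}. Proof. by []. Qed.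

Lemma fst_continuous : continuous (fst : GZ -> G).
Proof. by move=> z; exact: cvg_fst. Qed.

Lemma fst_topologically_fg (K : set GZ) :
  closed K -> topologically_fg K -> topologically_fg (fst @` K).
Proof.
move=> cK [S Sfin KS]; exists (fst @` S); first exact: finite_image.
apply/seteqP; split.
  move=> g; rewrite {1}KS => /(closure_image fst_continuous).
  apply: closureS => _ [z zS <-];
    pose Z := fst @^-1` subgroup_gen (fst @` S) : set GZ.
  have /subgroup_gen_min sZ : is_subgroup Z.
    by apply: (is_subgroup_preimage fstM); exact: subgroup_gen_subgroup.
  by apply: (sZ _ _ _ zS) => s Ss; apply: sub_subgroup_gen; exists s.
have /closure_id -> := fst_closed cK; apply: closureS.
apply: subgroup_gen_min.
  apply: (is_subgroup_image fstM); rewrite KS; apply: closure_subgroup.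
  exact: subgroup_gen_subgroup.
move=> _ [s Ss <-]; exists s => //.
by rewrite KS; apply: subset_closure; exact: sub_subgroup_gen.
Qed.

(* The third hypothesis is the only consequence of [frattini p K (1, s ^+ p)]
   that is needed. If [s] has valuation [k] and [K] misses [(1, s)], then [t]
   mod [p^(k+1)] is a function of [h] for [(h, t)] in [K]; lifting it mod
   [p^(k+2)] to [phi] on the projection of [K] gives the character [t - phi
   h] of [K], which does not vanish at [(1, s ^+ p)]. *)
Lemma product_root_central (K : set GZ) (s : padic_int p) :
  is_closed_subgroup K -> topologically_fg K ->
  (forall (A : zmodType) (eta : GZ -> A), hom_on K eta ->
    (forall z, K z -> eta z *+ p = 0)%R -> eta (1, s ^+ p) = 0%R) ->
  K (1, s ^+ p) -> K (1, s).
Proof.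
move=> cK fK eta0 Ksp; apply: contrapT => nKs; have [sK clK] := cK.
have [K1 KM KV] := sK; have pG := demushkin_pro_p p_pr Fx piR.
have [[_ Gh _] _] := pG.
have exk : exists k, s k != 0%R.
  apply: contrapT => s0; apply: nKs; rewrite (_ : s = 1) //.
  by apply: padic_intP => k; apply/eqP/negPn/negP => sk; apply: s0; exists k.
(* Residues at level [0] are trivial, so the least level where [s] is nonzero is a successor, and
   the new [k] is the valuation of [s]. *)
have [k sk kmin] := ex_minnP exk; case: k => [|k] in sk kmin.
  by case/eqP: sk; rewrite (padic_resP s) expn0 modz1.
have {}kmin : s k = 0%R by apply/eqP/negPn/negP => /kmin; rewrite ltnn.
(* Otherwise powers of [t^-1] would approximate [s], and [K] is closed. *)
have Kcentral t : K (1, t) -> t k.+1 = 0%R.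
  move=> Kt; apply/eqP/negPn/negP => tk; apply: nKs; apply: clK.
  move=> U [[A B] /= [A1 [m mB]] ABU].
  have [l tl] := padic_divides p_pr kmin tk (leq_maxr m k.+1).
  exists (1, t^-1 ^+ l); split.
    have := is_subgroupX l sK (KV _ Kt); rewrite pair_expE /=.
    by rewrite invg1 expg1n.
  apply: ABU; split; first exact: nbhs_singleton.
  by apply: mB; apply: (padic_ball_le (leq_maxl m k.+1)).
have Kfiber h t t' : K (h, t) -> K (h, t') ->
    (padic_red k.+2 t *+ p = padic_red k.+2 t' *+ p)%R.
  move=> Kt Kt'; have := KM _ _ Kt (KV _ Kt').
  rewrite -[(h, t) * _]/(h * h^-1, t * t'^-1) mulgV => /Kcentral /eqP.
  have redh := padic_red_hom p_pr (ltn0Sn k.+1).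
  rewrite -(padic_red_eq0 p_pr) padic_redM // (hom_onV (@is_subgroupT _) redh)
    //.
  by rewrite mulrnBl subr_eq0 => /eqP.
(* The class of [t] mod p^(k+1), embedded in Z/p^(k+2) through multiplication by [p]; [0] is a junk
   value off the projection of [K]. *)
pose psi h : 'Z_(p ^ k.+2) := if pselect (exists t, K (h, t)) is left E
  then (padic_red k.+2 (projT1 (cid E)) *+ p)%R else 0%R.
have psiE h t : K (h, t) -> psi h = (padic_red k.+2 t *+ p)%R.
  move=> Kt; rewrite /psi; case: pselect => [E|[]]; last by exists t.
  by case: cid => t' Kt' /=; exact: Kfiber Kt' Kt.
have cfK : is_closed_subgroup (fst @` K).
  by split; [exact: (is_subgroup_image fstM)|exact: fst_closed].
have psiK : hom_on (fst @` K) psi.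
  split=> [_ _ [[g t] Kt <-] [[h t'] Kt' <-]|] /=.
    rewrite (psiE _ _ Kt) (psiE _ _ Kt') -mulrnDl -padic_redM //.
    by apply: psiE; exact: KM Kt Kt'.
  (* For the continuity of [psi]: by compactness [Z] has a closed projection, which misses [1], and
     [psi] vanishes at the other points of the projection of [K]. *)
  pose Z := K `&` snd @^-1` [set t : padic_int p | t k.+1 != 0%R].
  have cZ : closed (fst @` Z).
    apply: fst_closed; apply: closedI => //.
    by apply: preimage_closed (@padic_closed p k.+1) => z _; exact: cvg_snd.
  have Z1 : (~` (fst @` Z)) 1.
    by move=> [[h t] /= [Kt tk] h1]; move: Kt tk;
      rewrite /= h1 => /Kcentral -> /eqP.
  have := open_nbhs_nbhs (conj (closed_openC cZ) Z1).
  apply: filterS => h nZ [[h' t] Kt /= hE]; move: nZ; rewrite -hE => nZ.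
  rewrite (psiE _ _ Kt); apply/eqP; rewrite padic_red_eq0 //.
  by apply/negPn/negP => tk; apply: nZ; exists (h', t).
have [||phi phiK phiE] := demushkin_divisible_hom p_pr n_gt0 Fx xr piR
  (Zp_exponent p_pr (ltn0Sn k.+1)) cfK _ psiK.
- exact: fst_topologically_fg.
- by move=> _ [[h t] Kt <-]; exists (padic_red k.+2 t); exact: psiE.
have sKfst : is_subgroup (fst @` K) by case: cfK.
pose eta (z : GZ) := (padic_red k.+2 z.2 - phi z.1)%R.
have fK' z : K z -> (fst @` K) z.1 by move=> Kz; exists z.
have etaK : hom_on K eta.
  split=> [[h t] [h' t'] Kz Kw|].
    have phiM : phi (h * h') = (phi h + phi h')%R := hom_onM phiK (fK' _ Kz)
      (fK' _ Kw).
    have redM := padic_redM p_pr t t' (ltn0Sn k.+1).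
    have -> : eta ((h, t) * (h', t')) = (padic_red k.+2 (t * t')%g - phi (h *
      h')%g)%R by [].
    by rewrite phiM redM opprD addrACA.
  have [_ phi1] := phiK.
  exists ([set h | (fst @` K) h -> phi h = 0%R], [set t | padic_red k.+2 t =
    0%R]).
    by split=> //; exact: padic_red_nbhs.
  by move=> [h t] [/= phih redt] Kht; rewrite /eta /= redt phih ?subr0 //;
    exact: fK' Kht.
have etap z : K z -> (eta z *+ p = 0)%R.
  case: z => h t Kz; rewrite /eta mulrnBl phiE; last exact: fK' Kz.
  by rewrite (psiE _ _ Kz) subrr.
have := eta0 _ _ etaK etap.
rewrite /eta /= (hom_on1 sKfst phiK) subr0.
rewrite (hom_onX (@is_subgroupT _) (padic_red_hom p_pr (ltn0Sn k.+1))) // =>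
  /eqP.
by rewrite padic_red_eq0 // (negPf sk).
Qed.

(** By [demushkin_root] for the projection of [K], [z] is some [u] in [K] times a central [(1, s)].
    A [p]-torsion character of [K] kills both [z ^+ p] and [u ^+ p], hence [(1, s ^+ p)]. *)
Lemma product_root (K : set GZ) (z : GZ) :
  is_closed_subgroup K -> topologically_fg K -> frattini p K (z ^+ p) -> K z.
Proof.
move=> cK fK Kz; have [sK clK] := cK; have [K1 KM KV] := sK.
have cfK : is_closed_subgroup (fst @` K).
  by split; [exact: (is_subgroup_image fstM)|exact: fst_closed].
have [u Ku uz] : (fst @` K) z.1.
  apply: (demushkin_root p_pr n_gt0 Fx xr piR cfK (fst_topologically_fg clK
    fK)).
  apply: (frattini_image fstM fst_continuous); exists (z ^+ p) => //.
  by rewrite pair_expE.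
pose s := u.2^-1 * z.2.
have zE : z = u * (1, s).
  by case: z u uz @s {Kz Ku} => [h t] [h' t'] /= -> ; congr pair;
    rewrite /= ?mulg1 ?mulVKg.
have zpE : z ^+ p = u ^+ p * (1, s ^+ p).
  rewrite zE expgMn; last first.
    by congr pair; rewrite /= ?mulg1 ?mul1g //; exact: padic_mulC.
  by congr (_ * _); rewrite pair_expE expg1n.
have Ksp : K (1, s ^+ p).
  have := KM _ _ (KV _ (is_subgroupX p sK Ku)) (frattini_subset cK Kz).
  by rewrite zpE mulKg.
rewrite zE; apply: KM => //; apply: product_root_central => // A eta etaK etap.
have := hom_on_frattini cK etaK etap Kz.
by rewrite zpE (hom_onM etaK) ?(hom_onX sK etaK) ?etap ?add0r //;
  exact: is_subgroupX.
Qed.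

End Roots.

(** * Failure of strong resistance *)

Lemma padic_one_subproof (p k : nat) :
  (1 %% (p ^ k)%N)%Z = ((1 %% (p ^ k.+1)%N)%Z %% (p ^ k)%N)%Z.
Proof. by rewrite modz_expS. Qed.

(** The integer one; the [1] of the group law is zero. *)
Definition padic_one (p : nat) : padic_int p := PadicInt (@padic_one_subproof
  p).

Section Product.
Variables (p n : nat) (G F : topGroupType) (x : nat -> F) (r : F) (pi : F -> G).
Hypotheses (p_pr : prime p) (n_gt0 : (0 < n)%N) (Fx : is_free_pro_p p x).
Hypothesis xr : demushkin_partial p n x @ \oo --> r.
Hypothesis piR :
  is_quotient_map (smallest (@is_closed_normal_subgroup F) [set r]) pi.
Local Notation GZ := (G * padic_int p)%type.

(** Evaluate the relator in [K]: its partial products lie in the Frattini subgroup, as [0 < n], and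
    converge to [(1, s ^+ (p ^ n))], since [pi r = 1] and the commutators vanish in the second
    factor. *)
Lemma product_frattini_central (K : set GZ) (s : padic_int p) :
  is_subgroup K -> K (pi (x 0%N), s) -> (forall i, K (pi (x i.+1), 1)) ->
  frattini p K (1, s ^+ (p ^ n)).
Proof.
move=> sK Kx0 Kx; have [piM _ _ _] := piR.
pose w k : GZ := (pi (demushkin_partial p n x k), s ^+ (p ^ n)).
suff wK k : frattini p K (w k).
  have cpi U : nbhs 1 U -> nbhs r (pi @^-1` U).
    by rewrite -(demushkin_relator piR) => /(quotient_map_continuous piR).
  apply: (@closed_closure GZ) => B [[C D] /= [C1 D1] CDB].
  have [N _ /(_ N (leqnn N)) CN] := xr (cpi _ C1).
  exists (w N); split; first exact: wK.
  by apply: (CDB (w N)); split=> //; exact: nbhs_singleton D1.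
pose y i : GZ := (pi (x i), if i == 0%N then s else 1).
have Ky i : K (y i) by case: i => [|i]; [exact: Kx0|exact: Kx].
have sD : is_subgroup (derived_subgroup K) by exact: subgroup_gen_subgroup.
have [D1 DM DV] := sD.
pose c k : GZ := \prod_(i < k) [~ y i.*2, y i.*2.+1].
have cD : derived_subgroup K (c k).
  rewrite /c; elim: k => [|k IH]; first by rewrite big_ord0.
  rewrite big_ord_recr; apply: DM IH _.
  by apply: sub_subgroup_gen; exists (y k.*2) => //; exists (y k.*2.+1).
apply: subset_closure; exists (y 0%N ^+ (p ^ n)).
  rewrite -(prednK n_gt0) expnSr expgnA.
  by apply: sub_subgroup_gen; exists (y 0%N ^+ (p ^ n.-1)) => //;
    exact: is_subgroupX.
exists (c k) => //; rewrite /w /demushkin_partial piM (morphismX piM) pair_expE.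
suff -> : c k = (pi (\prod_(i < k) [~ x i.*2, x i.*2.+1]), 1).
  by congr pair; exact: mulg1.
rewrite /c; elim: k {cD} => [|k IH]; first by rewrite !big_ord0 (morphism1 piM).
rewrite !big_ord_recr /= IH piM (morphismR piM); congr pair.
rewrite /= mul1g; apply/eqP/commgP; exact: padic_mulC.
Qed.

Lemma product_not_strongly_resistant : ~ strongly_frattini_resistant p GZ.
Proof.
have pn_gt1 : (1 < p ^ n)%N by rewrite -(exp1n n) ltn_exp2r // prime_gt1.
have [||chi [chiM chi1 chix]] := demushkin_character p_pr Fx xr piR
  (A := 'Z_(p ^ n)) (f := fun i => if i == 0%N then 1%R else 0%R).
- by move=> a; rewrite -mulr_natr pchar_Zp // mulr0.
- by exists 1%N => // -[].
pose e (z : GZ) := (padic_red n z.2 - chi z.1)%R.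
have eT : hom_on [set: GZ] e.
  split=> [[g s] [h t] _ _|].
    have redM := padic_redM p_pr s t n_gt0.
    have -> : e ((g, s) * (h, t)) = (padic_red n (s * t)%g - chi (g * h)%g)%R by
      [].
    by rewrite redM chiM opprD addrACA.
  exists ([set h | chi h = 0%R], [set t | padic_red n t = 0%R]).
    by split=> //; exact: padic_red_nbhs.
  by move=> [h t] [/= chih redt] _; rewrite /e /= redt chih subr0.
pose K := [set z : GZ | [set: GZ] z /\ e z = 0%R].
have sK : is_subgroup K := hom_on_kernel (@is_subgroupT GZ) eT.
have cK : closed K by exact: hom_on_kernel_closed (@is_subgroupT GZ) eT
  (@closedT GZ).
pose s := padic_one p.
have red_s : padic_red n s = 1%R by rewrite /padic_red /= Zp_intr_mod.
have red_1 : padic_red n (1 : padic_int p) = 0%R by [].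
have chi_1 : chi 1 = 0%R.
  by apply: (@addrI _ (chi 1)); rewrite -chiM mulg1 addr0.
have Ks : frattini p K (1, s ^+ (p ^ n)).
  apply: product_frattini_central => //.
    by split=> //; rewrite /e /= red_s chix subrr.
  by move=> i; split=> //; rewrite /e /= red_1 chix subrr.
(* [H] is commutative, so its Frattini subgroup comes from [p]-th powers and lies in that of [K]; it
   contains [(1, s ^+ (p ^ n.-1))], which is not in [K]. *)
pose H := [set z : GZ | z.1 = 1 /\ frattini p K (z ^+ p)].
have [F1 FM FV] := frattini_subgroup p sK.
have Hcomm (z w : GZ) : z.1 = 1 -> w.1 = 1 -> commute z w.
  case: z w => [g a] [h b] /= -> ->; congr pair; exact: padic_mulC.
have cH : is_closed_subgroup H.
  split; first split.
  - by split=> //; rewrite expg1n.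
  - move=> z w [z1 Fz] [w1 Fw]; split; first by rewrite /= z1 w1 mulg1.
    by rewrite expgMn; [exact: FM|exact: Hcomm].
  - move=> z [z1 Fz]; split; first by rewrite /= z1 invg1.
    by rewrite expVgn; exact: FV.
  have pG := demushkin_pro_p p_pr Fx piR; have [[_ Gh _] _] := pG.
  apply: closedI.
    have c1 : closed [set (1 : G)].
      exact/accessible_closed_set1/hausdorff_accessible.
    by apply: preimage_closed c1 => z _; exact: fst_continuous.
  have cF : closed (frattini p K) by exact: closed_closure.
  by apply: preimage_closed cF => z _; exact: expgn_continuous.
move=> /(_ H K cH (conj sK cK)) [HK _].
have FHK : frattini p H `<=` frattini p K.
  apply: frattini_min; first by split; [split|exact: closed_closure].
    by move=> h [].
  move=> z w [z1 _] [w1 _]; have /commgP/eqP -> := Hcomm _ _ z1 w1.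
  exact: F1.
have [_] : K (1, s ^+ (p ^ n.-1)).
  apply: HK => //; split=> //.
  by rewrite pair_expE /= expg1n -expgnA -expnSr prednK.
rewrite /e /= chi_1 subr0.
rewrite (hom_onX (@is_subgroupT _) (padic_red_hom p_pr n_gt0)) // red_s => /eqP.
by rewrite Zp_natr_eq0 // dvdn_Pexp2l ?prime_gt1 // -{1}(prednK n_gt0) ltnn.
Qed.

End Product.

Theorem corollary1p4 (p n : nat) (G : topGroupType) :
  prime p -> (0 < n)%N -> is_demushkin_infinite_rank p n G ->
  [/\ is_pro_p p (G * padic_int p)%type,
      frattini_resistant p (G * padic_int p)%type
    & ~ strongly_frattini_resistant p (G * padic_int p)%type].
Proof.
move=> p_pr n_gt0 [F [x [r [pi [Fx xr piR]]]]]; split.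
- exact: (product_pro_p p_pr (demushkin_pro_p p_pr Fx piR)).
- apply: frattini_resistantP => K z cK fK.
  exact: (product_root p_pr n_gt0 Fx xr piR cK fK).
- exact: (product_not_strongly_resistant p_pr n_gt0 Fx xr piR).
Qed.
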